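(* Let $T$ be a complete VC-minimal first-order theory with monster model $\mathcal{U}$, and let $\varphi(x;y)$ be any partitioned formula with $|y| \le 2$. Then $\varphi$ has VC-density $\le 2$; that is, there is $K<\omega$ such that for every finite $A \subseteq \mathcal{U}_x$, $|S_{\varphi^{\mathrm{opp}}}(A)| \le K\cdot |A|^2$, where $\varphi^{\mathrm{opp}}(y;x) := \varphi(x;y)$.
   Context: For a tuple of variables $x$, $|x|$ is its length and $\mathcal{U}_x = \mathcal{U}^{|x|}$. For a formula $\psi(u;v)$ (partitioned into object variables $u$ and parameter variables $v$) and $B\subseteq \mathcal{U}_v$, $S_\psi(B)$ is the set of maximal consistent subsets of $\{\psi(u;b)^t : b\in B, t<2\}$, where $\theta^1=\theta$ and $\theta^0=\neg\theta$. The formula $\psi(u;v)$ has VC-codensity $\le \ell$ if there is $K<\omega$ with $|S_\psi(B)|\le K|B|^\ell$ for all finite $B\subseteq\mathcal{U}_v$; $\varphi(x;y)$ has VC-density $\le \ell$ if $\varphi^{\mathrm{opp}}(y;x):=\varphi(x;y)$ has VC-codensity $\le \ell$. A set $\Delta=\{\delta_i(x;y_i): i\in I\}$ of formulas with a fixed single variable $x$ is directed if for any instances $\delta_i(x;b),\delta_j(x;b')$, the defined sets $D=\delta_i(\mathcal{U};b)$, $E=\delta_j(\mathcal{U};b')$ satisfy $D\subseteq E$, $E\subseteq D$, or $D\cap E=\emptyset$. $T$ is VC-minimal if there is a directed set $\Delta$ of formulas with $|x|=1$ such that every formula $\theta(x)$ with parameters, $|x|=1$, is $T$-equivalent to a boolean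 combination of instances of $\Delta$.
   Formalization: The bound is stated for nonempty finite A only: for A empty, the set of types has exactly one element (the empty set), while K·|A|^2 = 0, so the inequality as written fails there. *)

(* Defs.v *)
From mathcomp Require Import all_boot.
From mathcomp Require Import boolp classical_sets functions cardinality.

Set Implicit Arguments.
Unset Strict Implicit.
Unset Printing Implicit Defensive.

Local Open Scope classical_set_scope.
Local Open Scope card_scope.

(** * First-order logic with equality *)

Record language := Language {
  fsym : Type; farity : fsym -> nat;
  rsym : Type; rarity : rsym -> nat }.

(* Well-scoped syntax: [term L n] and [formula L n] have their free variables
   among x_0, ..., x_(n-1).  In [Ex f] the bound variable is variable 0 of [f]
   and variable i of [Ex f] is variable i+1 of [f]. *)
Inductive term (L : language) (n : nat) : Type :=
| Var of 'I_n
| App (f : fsym L) of ('I_(farity f) -> term L n).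

Inductive formula (L : language) : nat -> Type :=
| Bot n : formula L n
| Eq n of term L n & term L n : formula L n
| Rel n (r : rsym L) of ('I_(rarity r) -> term L n) : formula L n
| Neg n of formula L n : formula L n
| And n of formula L n & formula L n : formula L n
| Ex n of formula L n.+1 : formula L n.

Arguments Var {L n}.
Arguments App {L n}.
Arguments Bot {L n}.
Arguments Rel {L n}.

Record structure (L : language) := Structure {
  carrier :> Type;
  carrier_inh : inhabited carrier;
  fint : forall f : fsym L, ('I_(farity f) -> carrier) -> carrier;
  rint : forall r : rsym L, ('I_(rarity r) -> carrier) -> Prop }.

Arguments fint {L} s f.
Arguments rint {L} s r.

Section Semantics.
Variables (L : language) (U : structure L).

Fixpoint teval n (t : term L n) (v : n.-tuple U) : U :=
  match t with
  | Var i => tnth v i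
  | App f ts => fint U f (fun i => teval (ts i) v)
  end.

Fixpoint holds n (phi : formula L n) : n.-tuple U -> Prop :=
  match phi in formula _ n return n.-tuple U -> Prop with
  | Bot _ => fun _ => False
  | Eq _ t u => fun v => teval t v = teval u v
  | Rel _ r ts => fun v => rint U r (fun i => teval (ts i) v)
  | Neg _ f => fun v => ~ holds f v
  | And _ f g => fun v => holds f v /\ holds g v
  | Ex _ f => fun v => exists a : U, holds f [tuple of a :: v]
  end.

End Semantics.

(** * Renaming of variables *)

Section Renaming.
Variable L : language.

Definition lift_ren n m (r : 'I_n -> 'I_m) (i : 'I_n.+1) : 'I_m.+1 :=
  if unlift ord0 i is Some j then lift ord0 (r j) else ord0.

Fixpoint trename n m (r : 'I_n -> 'I_m) (t : term L n) : term L m :=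
  match t with
  | Var i => Var (r i)
  | App f ts => App f (fun i => trename r (ts i))
  end.

Fixpoint rename n (phi : formula L n) : forall m, ('I_n -> 'I_m) -> formula L m :=
  match phi in formula _ n return forall m, ('I_n -> 'I_m) -> formula L m with
  | Bot _ => fun m r => Bot
  | Eq _ t u => fun m r => Eq (trename r t) (trename r u)
  | Rel _ R ts => fun m r => Rel R (fun i => trename r (ts i))
  | Neg _ f => fun m r => Neg (rename f r)
  | And _ f g => fun m r => And (rename f r) (rename g r)
  | Ex _ f => fun m r => Ex (rename f (lift_ren r))
  end.

Lemma teval_rename (U : structure L) n m (r : 'I_n -> 'I_m) (t : term L n)
    (v : m.-tuple U) :
  teval (trename r t) v = teval t [tuple tnth v (r i) | i < n].
Proof.
elim: t => [i|f ts IH] /=; first by rewrite tnth_mktuple.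
by congr (fint U f _); apply: funext => i; rewrite IH.
Qed.

Lemma holds_rename (U : structure L) n (phi : formula L n) m (r : 'I_n -> 'I_m)
    (v : m.-tuple U) :
  holds (rename phi r) v <-> holds phi [tuple tnth v (r i) | i < n].
Proof.
elim: phi m r v => {n} [n|n t u|n R ts|n f IH|n f IHf g IHg|n f IH] m r v //=.
- by rewrite !teval_rename.
- suff -> : (fun i => teval (trename r (ts i)) v) =
     (fun i => teval (ts i) [tuple tnth v (r i) | i < n]) by [].
  by apply: funext => i; rewrite teval_rename.
- by split=> H /IH.
- by split=> -[/IHf ? /IHg ?].
have E (a : U) : [tuple tnth [tuple of a :: v] (lift_ren r i) | i < n.+1] =
    [tuple of a :: [tuple tnth v (r i) | i < n]].
  apply: eq_from_tnth => i; rewrite tnth_mktuple /lift_ren.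
  by case: unliftP => [j ->|->]; rewrite ?tnthS ?tnth0 ?tnth_mktuple.
by split=> -[a Ha]; exists a; [rewrite -E; apply/IH | apply/IH; rewrite E].
Qed.

End Renaming.

(** * Partitioned formulas and formulas with parameters *)

(* A partitioned formula phi(x; y) with |x| = n and |y| = m is an element of
   [formula L (n + m)]: the first n variables are x, the last m are y. *)

Section Partitioned.
Variable L : language.

Definition swap_ord n m (i : 'I_(n + m)) : 'I_(m + n) :=
  match fintype.split i with inl j => rshift m j | inr k => lshift n k end.

Definition opp n m (phi : formula L (n + m)) : formula L (m + n) :=
  rename phi (@swap_ord n m).

Lemma holds_opp (U : structure L) n m (phi : formula L (n + m))
    (a : n.-tuple U) (b : m.-tuple U) :
  holds (opp phi) [tuple of b ++ a] <-> holds phi [tuple of a ++ b].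
Proof.
rewrite holds_rename.
suff -> : [tuple tnth [tuple of b ++ a] (swap_ord i) | i < n + m] =
  [tuple of a ++ b] by [].
apply: eq_from_tnth => i; rewrite tnth_mktuple /swap_ord.
case: (splitP i) => j ij.
  have -> : i = lshift m j by exact: val_inj.
  by rewrite tnth_lshift tnth_rshift.
have -> : i = rshift n j by exact: val_inj.
by rewrite tnth_lshift tnth_rshift.
Qed.

Variable U : structure L.

(* theta(x; c) with |x| = n, c a tuple from U *)
Record pformula (n : nat) := PFormula {
  plen : nat;
  pform : formula L (n + plen);
  ppar : plen.-tuple U }.

Definition pholds n (theta : pformula n) (a : n.-tuple U) : Prop :=
  holds (pform theta) [tuple of a ++ ppar theta].

Definition defset n (theta : pformula n) : set (n.-tuple U) :=
  [set a | pholds theta a].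

Definition inst n m (psi : formula L (n + m)) (b : m.-tuple U) : pformula n :=
  PFormula psi b.

Definition pneg n (theta : pformula n) : pformula n :=
  PFormula (Neg (pform theta)) (ppar theta).

Definition emb1 n k l (i : 'I_(n + k)) : 'I_(n + (k + l)) :=
  match fintype.split i with
  | inl j => lshift (k + l) j
  | inr j => rshift n (lshift l j)
  end.

Definition emb2 n k l (i : 'I_(n + l)) : 'I_(n + (k + l)) :=
  match fintype.split i with
  | inl j => lshift (k + l) j
  | inr j => rshift n (rshift k j)
  end.

(* theta(x; c) /\ eta(x; d), with parameter tuple the concatenation of c, d *)
Definition pand n (theta eta : pformula n) : pformula n :=
  PFormula
    (And (rename (pform theta) (@emb1 n (plen theta) (plen eta)))
         (rename (pform eta) (@emb2 n (plen theta) (plen eta))))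
    [tuple of ppar theta ++ ppar eta].

Lemma pholds_and n (theta eta : pformula n) (a : n.-tuple U) :
  pholds (pand theta eta) a <-> pholds theta a /\ pholds eta a.
Proof.
case: theta eta => [k phi c] [l psi d]; rewrite /pholds /= !holds_rename.
set v := [tuple of a ++ _].
suff [-> ->] : [tuple tnth v (@emb1 n k l i) | i < n + k] = [tuple of a ++ c] /\
    [tuple tnth v (@emb2 n k l i) | i < n + l] = [tuple of a ++ d] by [].
split; apply: eq_from_tnth => i; rewrite tnth_mktuple /emb1 /emb2.
  case: (splitP i) => j ij.
    have -> : i = lshift k j by exact: val_inj.
    by rewrite !tnth_lshift.
  have -> : i = rshift n j by exact: val_inj.
  by rewrite !tnth_rshift tnth_lshift.
case: (splitP i) => j ij.
  have -> : i = lshift l j by exact: val_inj.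
  by rewrite !tnth_lshift.
have -> : i = rshift n j by exact: val_inj.
by rewrite !tnth_rshift.
Qed.

(* theta^1 = theta, theta^0 = not theta *)
Definition psign n (t : bool) (theta : pformula n) : pformula n :=
  if t then theta else pneg theta.

(* A set of formulas with parameters in U is consistent (with the theory of U
   with its elements named) iff it is finitely satisfiable in U. *)
Definition consistent n (p : set (pformula n)) : Prop :=
  forall q : set (pformula n), q `<=` p -> finite_set q ->
  exists a : n.-tuple U, forall theta, q theta -> pholds theta a.

End Partitioned.

(** * Theories and monster models *)

Definition theory (L : language) := set (formula L 0).

Definition models (L : language) (M : structure L) (T : theory L) : Prop :=
  forall sigma, T sigma -> holds sigma ([tuple] : 0.-tuple M).

Definition entails (L : language) (T : theory L) (sigma : formula L 0) : Prop :=
  forall M : structure L, models M T -> holds sigma ([tuple] : 0.-tuple M).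

Definition complete (L : language) (T : theory L) : Prop :=
  (exists M : structure L, models M T) /\
  (forall sigma, entails T sigma \/ entails T (Neg sigma)).

Section Monster.
Variables (L : language) (U : structure L).

(* |A| < |K| *)
Definition smaller (K X : Type) (A : set X) : Prop := ~~ ([set: K] #<= A).

Definition over n (A : set U) (theta : pformula U n) : Prop :=
  forall i, A (tnth (ppar theta) i).

Definition saturated (K : Type) : Prop :=
  forall (A : set U), smaller K A ->
  forall n (p : set (pformula U n)),
    p `<=` over A -> consistent p ->
    exists a : n.-tuple U, forall theta, p theta -> pholds theta a.

Definition partial_elementary (A : set U) (f : U -> U) : Prop :=
  forall n (phi : formula L n) (a : n.-tuple U), (forall i, A (tnth a i)) ->
    (holds phi a <-> holds phi [tuple of map f a]).

Definition automorphism (g : U -> U) : Prop :=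
  [/\ bijective g,
      forall (f : fsym L) a, g (fint U f a) = fint U f (g \o a)
    & forall (r : rsym L) a, rint U r a <-> rint U r (g \o a)].

Definition strongly_homogeneous (K : Type) : Prop :=
  forall (A : set U), smaller K A ->
  forall f : U -> U, partial_elementary A f ->
  exists2 g : U -> U, automorphism g & forall x, A x -> g x = f x.

(* kappa-saturated and strongly kappa-homogeneous for some cardinal
   kappa = |K| > |L| + aleph_0 *)
Definition monster : Prop := exists K : Type,
  [/\ smaller K [set: nat], smaller K [set: fsym L], smaller K [set: rsym L],
      saturated K & strongly_homogeneous K].

(** * VC-minimality *)

(* [Delta m] is the set of those members delta(x; y) of the family Delta for
   which |y| = m; here |x| = 1 throughout. *)
Definition directed (Delta : forall m, set (formula L (1 + m))) : Prop :=
  forall i (di : formula L (1 + i)) (b : i.-tuple U)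
         j (dj : formula L (1 + j)) (b' : j.-tuple U),
  Delta i di -> Delta j dj ->
  let D := defset (inst di b) in
  let E := defset (inst dj b') in
  [\/ D `<=` E, E `<=` D | D `&` E = set0].

Inductive bool_comb (Delta : forall m, set (formula L (1 + m))) :
    pformula U 1 -> Prop :=
| bool_comb_inst m (d : formula L (1 + m)) (b : m.-tuple U) :
    Delta m d -> bool_comb Delta (inst d b)
| bool_comb_neg theta : bool_comb Delta theta -> bool_comb Delta (pneg theta)
| bool_comb_and theta eta :
    bool_comb Delta theta -> bool_comb Delta eta ->
    bool_comb Delta (pand theta eta).

(* equivalence modulo the theory of U with the parameters named *)
Definition equivalent n (theta eta : pformula U n) : Prop :=
  forall a : n.-tuple U, pholds theta a <-> pholds eta a.

(* For a complete theory T with monster model U, this says that T is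
   VC-minimal. *)
Definition vc_minimal : Prop :=
  exists Delta : forall m, set (formula L (1 + m)),
    directed Delta /\
    forall theta : pformula U 1,
      exists2 beta : pformula U 1, bool_comb Delta beta & equivalent theta beta.

(** * VC-codensity and VC-density *)

Definition instances n m (psi : formula L (n + m)) (B : set (m.-tuple U)) :
    set (pformula U n) :=
  [set theta | exists b t, B b /\ theta = psign t (inst psi b)].

Definition types n m (psi : formula L (n + m)) (B : set (m.-tuple U)) :
    set (set (pformula U n)) :=
  [set p | [/\ p `<=` instances psi B, consistent p &
     forall q, q `<=` instances psi B -> consistent q -> p `<=` q -> q = p]].

(* B is required to be nonempty: [types psi set0] has exactly one element, so
   the bound K * |B| ^ l would fail at B = set0 for every psi when l > 0. *)
Definition vc_codensity_le n m (psi : formula L (n + m)) (l : nat) : Prop :=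
  exists K : nat, forall (k : nat) (B : set (m.-tuple U)),
    B !=set0 -> B #= `I_k -> types psi B #<= `I_(K * k ^ l).

Definition vc_density_le n m (phi : formula L (n + m)) (l : nat) : Prop :=
  vc_codensity_le (opp phi) l.

End Monster.

(* Main.v *)
Require Import Defs.
From mathcomp Require Import all_boot zify.
From mathcomp Require Import boolp.

Set Implicit Arguments.
Unset Strict Implicit.
Unset Printing Implicit Defensive.

(** For parameters [a] and [b], VC-minimality and saturation write the fiber
[{y : phi(a; b, y)}] as a symmetric difference of a bounded number of balls
(instances of the directed family).  The representations using the fewest balls
are closed under a meet and a join (counting the balls is submodular), and this
bounds the number of balls that occur in any of them; so these balls form a
finite set definable from [a] and [b].  The type over [A] of a pair [(b, c)] is
the generic type of the least such ball, over all [a] in [A], containing [c].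

It remains to see that for a fixed [a] the boundedly many generic types
attached to [(a, b)] take only O(|A|) values as [b] varies.  Finitely many
values of [b] can be listed so that every ball is convex, and then every
definable property of [b] changes boundedly often along the list.  The generic
types attached to [(a, b)] are not individually definable, only their set is,
so one cannot follow them separately.  Instead one links each element of [A] to
its successor, then the consecutive pairs which separate the generic types
differently to the next such pair, and so on: only O(|A|) tuples are ever
linked, and when no linked tuple changes its trace, the set of types does not
change. *)

(** * Variation along a list *)

Section AdjacentSums.
Variable X : Type.
Implicit Types (w : X -> X -> nat) (x : X) (s : seq X).

Fixpoint adjs w x s : nat :=
  if s is y :: s' then w x y + adjs w y s' else 0.

Lemma adjs_le w w' x s :
  (forall x y, w x y <= w' x y) -> adjs w x s <= adjs w' x s.
Proof. by move=> le; elim: s x => //= y s IH x; rewrite leq_add. Qed.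

Lemma adjsD w w' x s :
  adjs (fun x y => w x y + w' x y) x s = adjs w x s + adjs w' x s.
Proof. by elim: s x => //= y s IH x; rewrite IH addnACA. Qed.

Lemma adjs0 x s : adjs (fun _ _ => 0) x s = 0.
Proof. by elim: s x => //= y s IH x; rewrite IH. Qed.

Lemma adjsM c w x s : adjs (fun x y => c * w x y) x s = c * adjs w x s.
Proof. by elim: s x => [|y s IH] x /=; rewrite ?muln0 // IH mulnDr. Qed.

Lemma adjs_sum (I : Type) (r : seq I) (p : pred I) (w : I -> X -> X -> nat) x s :
  adjs (fun x y => \sum_(i <- r | p i) w i x y) x s =
  \sum_(i <- r | p i) adjs (w i) x s.
Proof.
elim: s x => [|y s IH] x /=; first by rewrite big1_eq.
by rewrite IH big_split.
Qed.

End AdjacentSums.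

Section Variation.
Variables (X : Type) (E : finType).
Implicit Types (P : X -> {set E}) (A B : {set E}).

Definition symd A B := #|A :\: B| + #|B :\: A|.

(** The start counts as a jump from the empty set, so this one number controls both the size of the
    sets and their changes. *)
Definition tvar P x s := #|P x| + adjs (fun x y => symd (P x) (P y)) x s.

Fixpoint ever P x s : {set E} :=
  P x :|: (if s is y :: s' then ever P y s' else set0).

(** An element that is ever present is there at the start or enters at some step, and each entry is
    counted in a symmetric difference. *)
Lemma card_ever P x s : #|ever P x s| <= tvar P x s.
Proof.
rewrite /tvar; elim: s x => [|y s IH] x /=; first by rewrite setU0 addn0.
have sub : P x :|: ever P y s \subset (P x :\: P y) :|: ever P y s.
  apply/subsetP => e; rewrite !inE; case: (boolP (e \in ever P y s)); rewrite ?orbT //.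
  move=> He; rewrite !orbF => ->; rewrite andbT; apply: contra He.
  by case: (s) => [|z s'] /= Hy; rewrite !inE Hy.
apply: leq_trans (subset_leq_card sub) _.
apply: leq_trans (leq_card_setU _ _) _.
have := IH y; rewrite /symd.
have : #|P y| <= #|P x| + #|P y :\: P x|.
  by rewrite -[X in X <= _](cardsID (P x)) leq_add2r subset_leq_card // subsetIr.
lia.
Qed.

(** Exchanging the sums charges each element that ever occurs with its jumps along the whole
    list. *)
Lemma adjs_ever P (w : E -> X -> X -> nat) x s :
  adjs (fun x y => \sum_(p in P x) w p x y) x s <=
  \sum_(p in ever P x s) adjs (w p) x s.
Proof.
elim: s x => [|y s IH] x /=; first by rewrite big1.
rewrite big_split leq_add //.
  by rewrite [leqRHS](big_setID (P x)) /= setUK leq_addr.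
apply: leq_trans (IH y) _.
by rewrite [leqRHS](big_setID (ever P y s)) /= setUC setUK leq_addr.
Qed.

End Variation.

(** * Consecutive pairs of a finite set *)

Section Consecutive.
Variable E : finType.
Implicit Types (A B : {set E}) (p q : E).

Definition between (p x q : E) := enum_rank p < enum_rank x < enum_rank q.

Definition consec A : {set E * E} :=
  [set pq | [&& pq.1 \in A, pq.2 \in A, enum_rank pq.1 < enum_rank pq.2 &
                [forall x in A, ~~ between pq.1 x pq.2]]].

Lemma consecP A p q :
  reflect [/\ p \in A, q \in A, enum_rank p < enum_rank q &
              forall x, x \in A -> ~~ between p x q]
          ((p, q) \in consec A).
Proof.
rewrite inE /=; apply: (iffP and4P) => -[pA qA pq h]; split=> //.
  exact/forall_inP.
exact/forall_inP.
Qed.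

Lemma consec_fst A p q q' :
  (p, q) \in consec A -> (p, q') \in consec A -> q = q'.
Proof.
move=> /consecP[_ qA pq h] /consecP[_ qA' pq' h'].
apply: enum_rank_inj; apply: val_inj => /=.
by move: (h _ qA') (h' _ qA); rewrite /between pq pq' /=; lia.
Qed.

Lemma consec_snd A p p' q :
  (p, q) \in consec A -> (p', q) \in consec A -> p = p'.
Proof.
move=> /consecP[pA _ pq h] /consecP[pA' _ pq' h'].
apply: enum_rank_inj; apply: val_inj => /=.
by move: pq pq' (h _ pA') (h' _ pA); rewrite /between /=; lia.
Qed.

Lemma consec_between A p q p' q' x :
  (p, q) \in consec A -> (p', q') \in consec A ->
  between p x q -> between p' x q' -> p = p'.
Proof.
move=> /consecP[pA qA pq h] /consecP[pA' qA' pq' h'] b b'.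
apply: enum_rank_inj; apply: val_inj => /=.
by move: (h _ pA') (h' _ pA) b b'; rewrite /between /=; lia.
Qed.

Lemma leq_card_consec A : #|consec A| <= #|A|.
Proof.
rewrite -(card_in_imset (f := fst) (D := mem (consec A))).
  by apply/subset_leq_card/subsetP => _ /imsetP[[p q] /consecP[pA _ _ _] ->].
by move=> [p q] [p' q'] H H' /= e; subst p'; rewrite (consec_fst H H').
Qed.

(** A pair consecutive in [A] but not in [B] has lost an endpoint or has an element of [B :\: A]
    between its endpoints. An element is first in at most one pair, second in at most one, and
    strictly between the members of at most one, which gives the three terms. *)
Lemma consec_diff A B :
  #|consec A :\: consec B| <= (#|A :\: B|).*2 + #|B :\: A|.
Proof.
pose C1 := [set pq in consec A | pq.1 \notin B].
pose C2 := [set pq in consec A | pq.2 \notin B].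
pose C3 := [set pq in consec A | [exists x in B :\: A, between pq.1 x pq.2]].
have in1 pq : (pq \in C1) = (pq \in consec A) && (pq.1 \notin B) by rewrite in_set.
have in2 pq : (pq \in C2) = (pq \in consec A) && (pq.2 \notin B) by rewrite in_set.
have in3 pq : (pq \in C3) =
    (pq \in consec A) && [exists x in B :\: A, between pq.1 x pq.2].
  by rewrite in_set.
have sub : consec A :\: consec B \subset C1 :|: C2 :|: C3.
  apply/subsetP => -[p q]; rewrite in_setD andbC => /andP[cA].
  rewrite !in_setU in1 in2 in3 cA /= [(p, q) \in _]inE /=.
  case: (boolP (p \in B)) => //= pB; case: (boolP (q \in B)) => //= qB.
  case/consecP: cA => pA qA -> h /=; case/forall_inPn => x xB.
  rewrite negbK => b; apply/existsP; exists x; rewrite !inE b xB !andbT.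
  by apply/negP => xA; move: (h x xA); rewrite b.
have c1 : #|C1| <= #|A :\: B|.
  rewrite -(@card_in_imset _ _ fst C1).
    apply/subset_leq_card/subsetP => _ /imsetP[[p q] + ->].
    by rewrite in1 => /andP[/consecP[pA _ _ _] pB]; rewrite inE pB.
  move=> [p q] [p' q']; rewrite !in1 => /andP[H _] /andP[H' _] /= e; subst p'.
  by rewrite (consec_fst H H').
have c2 : #|C2| <= #|A :\: B|.
  rewrite -(@card_in_imset _ _ snd C2).
    apply/subset_leq_card/subsetP => _ /imsetP[[p q] + ->].
    by rewrite in2 => /andP[/consecP[_ qA _ _] qB]; rewrite inE qB.
  move=> [p q] [p' q']; rewrite !in2 => /andP[H _] /andP[H' _] /= e; subst q'.
  by rewrite (consec_snd H H').
have c3 : #|C3| <= #|B :\: A|.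
  pose f (pq : E * E) := odflt pq.1 [pick x in B :\: A | between pq.1 x pq.2].
  have fP pq : pq \in C3 -> (f pq \in B :\: A) && between pq.1 (f pq) pq.2.
    rewrite in3 => /andP[_ /exists_inP[x xBA b]]; rewrite /f.
    by case: pickP => [y //|/(_ x)]; rewrite xBA b.
  rewrite -(@card_in_imset _ _ f C3).
    by apply/subset_leq_card/subsetP => _ /imsetP[pq /fP/andP[+ _] ->].
  move=> [p q] [p' q'] H H' e.
  have /andP[_ b] := fP _ H; have /andP[_] := fP _ H'; rewrite -e => b'.
  move: H H'; rewrite !in3 => /andP[H _] /andP[H' _].
  have pp : p = p' := consec_between H H' b b'.
  by subst p'; rewrite (consec_fst H H').
have := subset_leq_card sub; have [+ _] := leq_card_setU (C1 :|: C2) C3.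
by have [+ _] := leq_card_setU C1 C2; rewrite -addnn; lia.
Qed.

Lemma symd_consec A B : symd (consec A) (consec B) <= 3 * symd A B.
Proof. by have := consec_diff A B; have := consec_diff B A; rewrite /symd; lia. Qed.

(** The pairs of [consec A] link [A] into a path; the induction on the difference of ranks splits at
    an element in between. *)
Lemma consec_connected A (g : pred E) p :
  (forall p q, (p, q) \in consec A -> g p = g q) ->
  p \in A -> g p -> forall q, q \in A -> g q.
Proof.
move=> h pA gp q qA; rewrite -[g q](_ : g p = g q) //.
wlog le : p q pA qA {gp} / enum_rank p <= enum_rank q.
  move=> H; have [le|/ltnW le] := leqP (enum_rank p) (enum_rank q); first exact: H.
  by rewrite (H q p).
have [n] := ubnP (enum_rank q - enum_rank p).
elim: n p q pA qA le => // n IH p q pA qA le ln.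
have [e|ne] := eqVneq p q; first by rewrite e.
have lt : enum_rank p < enum_rank q.
  by rewrite ltn_neqAle le andbT (inj_eq val_inj) (inj_eq enum_rank_inj).
have [c|] := boolP ((p, q) \in consec A); first exact: h.
rewrite inE /= pA qA lt /= => /forall_inPn[x xA]; rewrite negbK => /andP[l1 l2].
rewrite (IH p x) ?(IH x q) //; by [exact: ltnW | move: l1 l2 ln; lia].
Qed.

End Consecutive.

(* [TT x] is the set of at most [N] types attached to [x], which only its traces
   on bounded sets see; restricting it to [supp p] partitions it into classes,
   and passing from the elements of [P] to the consecutive pairs with different
   kernels increases the number of classes, so that after [N] steps no pair is
   left. *)
Section FiniteCover.
Variables (n : nat) (X : Type) (TT : X -> {set {set 'I_n}}) (N : nat).
Hypothesis TT_gt0 : forall x, 0 < #|TT x|.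
Hypothesis TT_le : forall x, #|TT x| <= N.

Definition trace (F : {set {set 'I_n}}) (l : {set 'I_n}) : {set {set 'I_n}} :=
  [set S :&: l | S in F].

Variables (x0 : X) (s : seq X) (K W : nat).
Definition jump (l : {set 'I_n}) x y : nat := trace (TT x) l != trace (TT y) l.

Hypothesis trace_var : forall l : {set 'I_n}, #|l| <= W -> adjs (jump l) x0 s <= K.

Section Level.
Variables (E : finType) (supp : E -> {set 'I_n}).

Definition supp2 (pq : E * E) := supp pq.1 :|: supp pq.2.

(** The kernel of a restriction is the relation of having the same image. Both kernels are compared
    on the trace on [supp2 pq], so that the condition can change only when this trace does. *)
Definition same_kernel x (pq : E * E) :=
  [forall S in trace (TT x) (supp2 pq), forall S' in trace (TT x) (supp2 pq),
     (S :&: supp pq.1 == S' :&: supp pq.1) == (S :&: supp pq.2 == S' :&: supp pq.2)].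

Definition refined (P : X -> {set E}) x : {set E * E} :=
  [set pq in consec (P x) | ~~ same_kernel x pq].

Lemma in_trace (F : {set {set 'I_n}}) S (l : {set 'I_n}) : S \in F -> S :&: l \in trace F l.
Proof. exact: (imset_f (fun S => S :&: l)). Qed.

Lemma trace_trace (F : {set {set 'I_n}}) (l l' : {set 'I_n}) :
  l \subset l' -> trace F l = [set S :&: l | S in trace F l'].
Proof.
move=> /setIidPr sub; rewrite /trace -imset_comp; apply: eq_imset => S /=.
by rewrite -setIA sub.
Qed.

Lemma same_kernelP x pq T T' : same_kernel x pq -> T \in TT x -> T' \in TT x ->
  (T :&: supp pq.1 == T' :&: supp pq.1) = (T :&: supp pq.2 == T' :&: supp pq.2).
Proof.
move=> /forall_inP H hT hT'.
have := H _ (in_trace _ hT) => /forall_inP.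
move=> /(_ _ (in_trace _ hT')).
rewrite -!setIA /supp2 (setIidPr (subsetUl (supp pq.1) (supp pq.2))).
by rewrite (setIidPr (subsetUr (supp pq.1) (supp pq.2))) => /eqP.
Qed.

(** If the trace on [supp2 pq] gained nothing, its size would be at most that of the traces on
    either support; both restrictions would then be injective on it, with equal kernels, and the
    pair would not be in [refined]. *)
Lemma refined_rank r x (P : X -> {set E}) :
  (forall p, p \in P x -> N < #|trace (TT x) (supp p)| + r.+1) ->
  forall pq, pq \in refined P x -> N < #|trace (TT x) (supp2 pq)| + r.
Proof.
move=> hP [p q]; rewrite in_set => /andP[/consecP[/hP hp /hP hq _ _]].
apply: contraR => /= le; apply/forall_inP => S hS; apply/forall_inP => S' hS'.
have key (l : {set 'I_n}) : l \subset supp2 (p, q) -> N < #|trace (TT x) l| + r.+1 ->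
    (S :&: l == S' :&: l) = (S == S').
  move=> sub hl; apply/eqP/eqP => [|-> //].
  have /imset_injP inj : #|[set S :&: l | S in trace (TT x) (supp2 (p, q))]|
      == #|trace (TT x) (supp2 (p, q))|.
    rewrite eqn_leq leq_imset_card -trace_trace //.
    by move: le hl; rewrite -leqNgt addnS ltnS /= => le le2; rewrite -(leq_add2r r); apply: leq_trans le le2.
  exact: inj.
by rewrite !key ?subsetUl ?subsetUr.
Qed.

(** Only types at [x] are matched by types at [y]: this is enough for no type to be lost when
    passing to the later points of a list. *)
Definition unstable (P : X -> {set E}) x y :=
  ~~ [&& P x == P y & [forall T in TT x, exists T' in TT y,
        [forall p in P x, T :&: supp p == T' :&: supp p]]].

End Level.

(** A type that agrees with [T] at one element of [P x] and on all refined pairs agrees with it at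
    all of [P x], because equal kernels carry the agreement across the other consecutive pairs. *)
Lemma stable_refined (E : finType) (supp : E -> {set 'I_n}) P x y :
  unstable (supp2 supp) (refined supp P) x y = false -> P x = P y ->
  (forall p, p \in P x -> trace (TT x) (supp p) = trace (TT y) (supp p)) ->
  (forall pq, pq \in consec (P x) ->
     trace (TT x) (supp2 supp pq) = trace (TT y) (supp2 supp pq)) ->
  unstable supp P x y = false.
Proof.
move=> /negbFE/andP[/eqP eQ /forall_inP good] eP h1 h2.
apply/negbF; rewrite eP eqxx /=; apply/forall_inP => T hT.
have [->|[p pP]] := set_0Vmem (P y).
  have /card_gt0P[T' hT'] := TT_gt0 y.
  by apply/exists_inP; exists T' => //; apply/forall_inP => p; rewrite inE.
(* The level below provides agreement on the refined pairs; when there are none, [T'] is chosen to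
   agree at one element, from which the propagation starts. *)
have [T' [hT' hQ [q qP hq]]] : exists T', [/\ T' \in TT y,
    forall pq, pq \in refined supp P x -> T :&: supp2 supp pq = T' :&: supp2 supp pq &
    exists2 q, q \in P y & T :&: supp q == T' :&: supp q].
  have [Q0|[pq pqQ]] := set_0Vmem (refined supp P x).
    have /imsetP[T' hT' e] : T :&: supp p \in trace (TT y) (supp p).
      by rewrite -h1 ?eP // in_trace.
    exists T'; split=> //; first by move=> pq; rewrite Q0 inE.
    by exists p => //; apply/eqP.
  have /exists_inP[T' hT' /forall_inP hQ] := good _ hT.
  exists T'; split=> //; first by move=> pq' /hQ/eqP.
  exists pq.1.
    by move: pqQ; case: (pq) => p' q'; rewrite inE eP => /andP[/consecP[]].
  have sub : supp pq.1 \subset supp2 supp pq by apply: subsetUl.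
  by rewrite -(setIidPr sub) !setIA (eqP (hQ _ pqQ)).
apply/exists_inP; exists T' => //; apply/forall_inP.
apply: (consec_connected _ qP hq) => {p pP q qP hq} p q c.
have [/[dup] pqQ|] := boolP ((p, q) \in refined supp P y).
  rewrite -eQ => /hQ e.
  rewrite -(setIidPr (subsetUl (supp p) (supp q))).
  rewrite -[in RHS](setIidPr (subsetUr (supp p) (supp q))) !setIA.
  by rewrite -[supp p :|: supp q]/(supp2 supp (p, q)) e !eqxx.
(* [T2] will be a type at [y] with the trace of [T] on both supports; as the kernels are equal, [T']
   agrees with it on one support exactly when it does on the other. *)
rewrite inE c /= negbK => ker.
have /imsetP[T2 hT2 e] : T :&: supp2 supp (p, q) \in trace (TT y) (supp2 supp (p, q)).
  by rewrite -h2 ?eP // in_trace.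
have ep : T :&: supp p = T2 :&: supp p.
  by rewrite -(setIidPr (subsetUl (supp p) (supp q))) !setIA e.
have eq : T :&: supp q = T2 :&: supp q.
  by rewrite -(setIidPr (subsetUr (supp p) (supp q))) !setIA e.
by rewrite ep eq; apply: (same_kernelP ker).
Qed.

(** The term [1 + 4 * K] pays for the changes of [P], the jumps on its supports ([K]) and those on
    its consecutive pairs ([3 * K]); passing to [refined] multiplies the bound on the variation by
    [3 * (1 + K)]. *)
Fixpoint rank_const r := if r is r'.+1 then (1 + 4 * K) + 3 * (1 + K) * rank_const r' else 0.

Lemma leq_symd_neq (E : finType) (A B : {set E}) : (A != B) <= symd A B.
Proof.
case: eqP => // /eqP; rewrite eqEsubset negb_and -!setD_eq0 -!card_gt0 /symd.
by case/orP; lia.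
Qed.

(** A pair enters or leaves [refined] only if it enters or leaves [consec], or if the comparison of
    its kernels changes, which makes the trace on [supp2] jump. *)
Lemma symd_refined (E : finType) (supp : E -> {set 'I_n}) P x y :
  symd (refined supp P x) (refined supp P y) <=
  symd (consec (P x)) (consec (P y)) +
  \sum_(pq in consec (P x)) jump (supp2 supp pq) x y.
Proof.
pose J := [set pq in consec (P x) | jump (supp2 supp pq) x y == 1].
have eJ : \sum_(pq in consec (P x)) jump (supp2 supp pq) x y = #|J|.
  rewrite -sum1_card [RHS](eq_bigl (fun pq => (pq \in consec (P x)) &&
     (jump (supp2 supp pq) x y == 1))); last by move=> pq; rewrite in_set.
  by rewrite big_mkcondr; apply: eq_bigr => pq _; rewrite /jump; case: (_ != _).
have sk pq : jump (supp2 supp pq) x y != 1 ->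
    same_kernel supp x pq = same_kernel supp y pq.
  by rewrite /jump eqb1 negbK /same_kernel => /eqP ->.
(* Jumping pairs with equal kernels at [x] can only enter and the others can only leave, so each is
   counted once. *)
rewrite eJ -(cardsID [set pq | same_kernel supp x pq] J) /symd.
set J1 := J :&: _; set J2 := J :\: _.
have in1 pq : (pq \in J1) = [&& pq \in consec (P x),
    jump (supp2 supp pq) x y == 1 & same_kernel supp x pq].
  by rewrite in_setI !in_set -andbA.
have in2 pq : (pq \in J2) = [&& ~~ same_kernel supp x pq, pq \in consec (P x) &
    jump (supp2 supp pq) x y == 1].
  by rewrite in_setD !in_set.
have inR z pq : (pq \in refined supp P z) =
    (pq \in consec (P z)) && ~~ same_kernel supp z pq by rewrite in_set.
have c1 : #|refined supp P x :\: refined supp P y| <= #|consec (P x) :\: consec (P y)| + #|J2|.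
  apply: leq_trans (leq_card_setU _ _).1; apply/subset_leq_card/subsetP => pq.
  rewrite in_setU 2!in_setD !inR in2 => /andP[+ /andP[cx nk]].
  rewrite cx nk /= negb_and negbK; case: (pq \in consec (P y)) => //= sy.
  by apply: contraT => /sk e; rewrite -e (negPf nk) in sy.
have c2 : #|refined supp P y :\: refined supp P x| <= #|consec (P y) :\: consec (P x)| + #|J1|.
  apply: leq_trans (leq_card_setU _ _).1; apply/subset_leq_card/subsetP => pq.
  rewrite in_setU 2!in_setD !inR in1 => /andP[+ /andP[cy nk]].
  rewrite cy negb_and negbK /=; case: (pq \in consec (P x)) => //= sx.
  by rewrite sx andbT; apply: contraT => /sk e; rewrite e (negPf nk) in sx.
by apply: leq_trans (leq_add c1 c2) _; rewrite addnACA [X in _ + X <= _]addnC.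
Qed.

(** A step is unstable for [P] only if [P] changes, a trace on a support or on a consecutive pair
    jumps, or the step is unstable for [refined]. Supports double at each level, whence [2 ^ r]; at
    level 0 the rank hypothesis leaves [P] empty. *)
Lemma unstable_bound r : forall (E : finType) (P : X -> {set E})
    (supp : E -> {set 'I_n}) w c,
  (forall e, #|supp e| <= w) -> w * 2 ^ r <= W ->
  (forall x p, p \in P x -> N < #|trace (TT x) (supp p)| + r) ->
  tvar P x0 s <= c ->
  adjs (fun x y => unstable supp P x y : nat) x0 s <= rank_const r * c.
Proof.
elim: r => [|r IH] E P supp w c suppw wW rk tv /=.
  rewrite mul0n -(adjs0 x0 s); apply: adjs_le => x y.
  have P0 z : P z = set0.
    apply/eqP; rewrite -subset0; apply/subsetP => p /rk; rewrite addn0.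
    move=> lt; have := leq_trans lt (leq_trans (leq_imset_card _ _) (TT_le z)).
    by rewrite ltnn.
  rewrite leqn0 eqb0 negbK !P0 eqxx /=; apply/forall_inP => T _.
  have /card_gt0P[T' hT'] := TT_gt0 y.
  by apply/exists_inP; exists T' => //; apply/forall_inP => p; rewrite inE.
have supp2w e : #|supp2 supp e| <= w * 2.
  have [+ _] := leq_card_setU (supp e.1) (supp e.2).
  by have := suppw e.1; have := suppw e.2; rewrite /supp2; lia.
have w2W : w * 2 * 2 ^ r <= W by rewrite -mulnA -expnS.
have [wW1 wW2] : w <= W /\ w * 2 <= W.
  by split; apply: leq_trans wW; rewrite -[leqLHS]muln1 ?expnS ?mulnA leq_mul // ?muln1 ?expn_gt0 //; lia.
pose C x := consec (P x).
have tvC : tvar C x0 s <= 3 * c.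
  apply: leq_trans (_ : 3 * tvar P x0 s <= _); last by rewrite leq_mul2l tv.
  rewrite /tvar mulnDr leq_add //.
    by apply: leq_trans (leq_card_consec _) _; rewrite leq_pmull.
  by rewrite -adjsM; apply: adjs_le => x y; apply: symd_consec.
pose jC := adjs (fun x y => \sum_(pq in C x) jump (supp2 supp pq) x y) x0 s.
pose jP := adjs (fun x y => \sum_(p in P x) jump (supp p) x y) x0 s.
have jCle : jC <= 3 * c * K.
  apply: leq_trans (adjs_ever _ _ _ _) _.
  apply: leq_trans (_ : \sum_(pq in ever C x0 s) K <= _).
    by apply: leq_sum => pq _; apply: trace_var; apply: leq_trans (supp2w _) _.
  by rewrite sum_nat_const leq_mul2r (leq_trans (card_ever _ _ _)) ?orbT.
have jPle : jP <= c * K.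
  apply: leq_trans (adjs_ever _ _ _ _) _.
  apply: leq_trans (_ : \sum_(p in ever P x0 s) K <= _).
    by apply: leq_sum => pq _; apply: trace_var; apply: leq_trans (suppw _) _.
  by rewrite sum_nat_const leq_mul2r (leq_trans (card_ever _ _ _)) ?orbT.
have tvQ : tvar (refined supp P) x0 s <= 3 * c + 3 * c * K.
  apply: leq_trans (_ : tvar C x0 s + jC <= _); last exact: leq_add.
  rewrite /tvar -addnA leq_add //.
    by apply/subset_leq_card/subsetP => pq; rewrite inE => /andP[].
  by rewrite -adjsD; apply: adjs_le => x y; apply: symd_refined.
have := IH _ (refined supp P) (supp2 supp) _ _ supp2w w2W _ tvQ.
move=> /(_ (fun x pq => @refined_rank _ _ r x P (fun p => rk x p) pq)) bQ.
apply: leq_trans (_ : tvar P x0 s + jP + jC +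
  adjs (fun x y => unstable (supp2 supp) (refined supp P) x y : nat) x0 s <= _); last first.
  by move: tv jCle jPle bQ; move: (adjs _ x0 s) => z; nia.
rewrite /tvar -!addnA; apply: leq_trans (leq_addl _ _).
rewrite -!adjsD; apply: adjs_le => x y.
have [eP|neP] := eqVneq (P x) (P y); last first.
  by apply: leq_trans (leq_b1 _) _; have := leq_symd_neq (P x) (P y); rewrite neP; lia.
have [h1|] := boolP [forall p in P x, trace (TT x) (supp p) == trace (TT y) (supp p)];
    last first.
  case/forall_inPn => p pP ne; apply: leq_trans (leq_b1 _) _.
  by rewrite (bigD1 p) //= {1}/jump ne; lia.
have [h2|] := boolP [forall pq in C x,
    trace (TT x) (supp2 supp pq) == trace (TT y) (supp2 supp pq)]; last first.
  case/forall_inPn => p pP ne; apply: leq_trans (leq_b1 _) _.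
  by rewrite [X in _ + (_ + (X + _))](bigD1 p) //= {2}/jump ne; lia.
have := @stable_refined E supp P x y; case: (unstable _ (refined _ _) x y) => [_|].
  by apply: leq_trans (leq_b1 _) _; lia.
by move=> -> // p pP; apply/eqP; [apply: (forall_inP h1) | apply: (forall_inP h2)].
Qed.

(** At the top level [P] is constantly all of ['I_n] with singleton supports, of total variation
    [n], and agreement on all singletons is equality. Hence a stable step loses no type, and an
    unstable one costs at most [N]. *)
Lemma card_ever_cover : 2 ^ N <= W ->
  #|ever TT x0 s| <= N * (1 + rank_const N * n).
Proof.
move=> W2; pose bd := unstable (fun i : 'I_n => [set i]) (fun=> setT).
have sub x y : bd x y = false -> TT x \subset TT y.
  move=> /negbFE/andP[_ /forall_inP good]; apply/subsetP => T hT.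
  have /exists_inP[T' hT' /forall_inP h] := good _ hT.
  suff -> : T = T' by [].
  apply/setP => i; have /eqP/setP/(_ i) := h i (in_setT _).
  by rewrite !inE eqxx !andbT.
apply: leq_trans (_ : N + N * adjs (fun x y => bd x y : nat) x0 s <= _).
  clear trace_var; elim: s x0 => [|y s' IH] x /=.
    by rewrite setU0 (leq_trans (TT_le x)) ?leq_addr.
  case E: (bd x y).
    have [+ _] := leq_card_setU (TT x) (ever TT y s').
    move=> le; apply: leq_trans le _; apply: leq_trans (leq_add (TT_le x) (IH y)) _.
    by rewrite mulnDr muln1.
  rewrite (setUidPr _) ?add0n; first exact: IH.
  by apply: subset_trans (sub _ _ E) _; case: (s') => *; apply: subsetUl.
rewrite -mulnS leq_mul2l add1n ltnS; apply/orP; right.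
apply: (@unstable_bound N _ _ _ 1) => [e|||]; rewrite ?cards1 ?mul1n //.
  move=> x p _; rewrite -[X in X < _]add0n ltn_add2r.
  have /card_gt0P[T hT] := TT_gt0 x.
  by apply/card_gt0P; exists (T :&: [set p]); apply: in_trace.
rewrite /tvar cardsT card_ord (_ : adjs _ _ _ = 0) ?addn0 //.
by rewrite -[RHS](adjs0 x0 s); apply/eqP; rewrite eqn_leq !adjs_le // => x y;
  rewrite /symd setDv cards0.
Qed.

End FiniteCover.

(** * Symmetric differences of sets from a laminar family *)

Section Laminar.
Variable U : Type.
Implicit Types (B C D E : U -> bool) (R F : seq (U -> bool)) (v : bool).

Definition subb B C : bool := `[< forall x, B x -> C x >].

Lemma subbP B C : reflect (forall x, B x -> C x) (subb B C).
Proof. exact: asboolP. Qed.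

Lemma subb_refl B : subb B B. Proof. exact/subbP. Qed.

Lemma subb_anti B C : subb B C -> subb C B -> B = C.
Proof.
move=> /subbP h /subbP h'; apply/funext => x.
by apply/idP/idP; [apply: h | apply: h'].
Qed.

Definition laminar (BB : (U -> bool) -> Prop) := forall B C, BB B -> BB C ->
  [\/ subb B C, subb C B | forall x, B x -> C x -> False].

Definition xors R x : bool := \big[addb/false]_(C <- R) C x.

(* The value on the part of [B] outside all smaller balls of [R] (even when that
   part is empty); [sabove] is the value just outside [B]. *)
Definition above R B : bool := \big[addb/false]_(C <- R) subb B C.

Definition sabove R B : bool :=
  \big[addb/false]_(C <- R) (subb B C && (B != C)).

Lemma xors_cons C R x : xors (C :: R) x = C x (+) xors R x.
Proof. by rewrite /xors big_cons. Qed.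

Lemma xors_cat R R' x : xors (R ++ R') x = xors R x (+) xors R' x.
Proof. by rewrite /xors big_cat. Qed.

Lemma xors_perm R R' x : perm_eq R R' -> xors R x = xors R' x.
Proof. by move=> p; rewrite /xors; apply: perm_big. Qed.

Lemma xors_filter p R x :
  xors (filter p R) x = \big[addb/false]_(C <- R) (p C && C x).
Proof. by rewrite /xors big_filter big_mkcond; apply: eq_bigr => C _; case: (p C). Qed.

Lemma big_mem R F (g : (U -> bool) -> bool) : uniq R -> uniq F -> {subset R <= F} ->
  \big[addb/false]_(B <- F) ((B \in R) && g B) = \big[addb/false]_(B <- R) g B.
Proof.
move=> uR uF sub; transitivity (\big[addb/false]_(B <- F | B \in R) g B).
  by rewrite [RHS]big_mkcond; apply: eq_bigr => B _; case: (B \in R).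
rewrite -big_filter; apply: perm_big; apply: uniq_perm => //.
  exact: filter_uniq.
by move=> B; rewrite mem_filter; case: (boolP (B \in R)) => // /sub ->.
Qed.

Lemma aboveE R B : uniq R -> above R B = sabove R B (+) (B \in R).
Proof.
move=> uR; rewrite /above /sabove.
have [BR|nBR] := boolP (B \in R).
  rewrite !(bigD1_seq B) //= subb_refl eqxx /= ?addbT ?addFb; congr negb.
  by apply: eq_bigr => C ne; rewrite eq_sym ne andbT.
rewrite addbF; apply: eq_big_seq => C CR.
by case: eqVneq => [e|]; rewrite ?andbT //; rewrite e CR in nBR.
Qed.

Variable BB : (U -> bool) -> Prop.
Hypothesis BBlam : laminar BB.

Definition xors_repr D R := (forall C, C \in R -> BB C) /\ forall x, xors R x = D x.

Definition minrep D R :=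
  xors_repr D R /\ forall R', xors_repr D R' -> size R <= size R'.

Lemma minrep_uniq D R : minrep D R -> uniq R.
Proof.
move=> [[RB RD] min]; apply: contraT => nu.
have [C CR CrR] : exists2 C, C \in R & C \in rem C R.
  elim: R nu {RB RD min} => //= C R IH; rewrite negb_and negbK.
  have [CR _|nCR /= /IH[B BR BrR]] := boolP (C \in R).
    by exists C; rewrite ?mem_head // eqxx.
  exists B; first by rewrite inE BR orbT.
  by case: eqP => // _; rewrite inE BrR orbT.
have p := perm_to_rem CR; have p' := perm_to_rem CrR.
have := min (rem C (rem C R)); rewrite !size_rem //.
have lt : 0 < size R by case: (R) CR.
have /[swap]/[apply] : xors_repr D (rem C (rem C R)).
  split=> [B /mem_rem/mem_rem/RB //|x].
  by rewrite -RD (xors_perm x p) xors_cons (xors_perm x p') xors_cons addKb.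
by case: (size R) lt => // k _ le; exfalso; move: le; rewrite succnK; lia.
Qed.

Lemma minrep_mem D R C : minrep D R -> C \in R -> exists x, C x.
Proof.
move=> [[RB RD] min] CR; apply: contrapT => nC.
have lt : 0 < size R by case: (R) CR.
have := min (rem C R); rewrite size_rem //.
have /[swap]/[apply] : xors_repr D (rem C R).
  split=> [B /mem_rem/RB //|x].
  rewrite -RD (xors_perm x (perm_to_rem CR)) xors_cons.
  by case E: (C x) => //; case: nC; exists x.
by case: (size R) lt => // k _; rewrite succnK ltnn.
Qed.

Definition opv v a b := if v then a && b else a || b.

(** These are the balls at which the meet (for [v = true]) or the join (for [v = false]) of the
    values given by [R] and [R'] differs from the same operation on the values just outside. *)
Definition merge v R R' := [seq B <- undup (R ++ R') |
  opv v (above R B) (above R' B) (+) opv v (sabove R B) (sabove R' B)].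

(** For nested balls the bracket is nonzero only at the smaller one; if [x] is not in both balls,
    every term vanishes. *)
Lemma smaller_of_two C C' F x : uniq F -> C \in F -> C' \in F ->
  BB C -> BB C' ->
  \big[addb/false]_(B <- F) (B x && ((subb B C && subb B C') (+)
     ((subb B C && (B != C)) && (subb B C' && (B != C'))))) = C x && C' x.
Proof.
move=> uF + + hC hC'; wlog: C C' hC hC' / subb C C' \/ (C x && C' x = false).
  move=> H CF C'F; have [h|h|h] := BBlam hC hC'.
  - by apply: H => //; left.
  - rewrite andbC -(H C' C) //; last by left.
    apply: eq_bigr => B _; congr (_ && (_ (+) _)); first exact: andbC.
    exact: andbC.
  - by apply: H => //; right; apply/negP => /andP[/h].
case=> [sub|e] CF C'F.
  rewrite (bigD1_seq C) //= big1 => [|B nB]; last first.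
    rewrite nB andbT; case: (boolP (subb B C)) => //= BC; last by rewrite andbF.
    have -> : subb B C' by apply/subbP => y /(subbP _ _ BC)/(subbP _ _ sub).
    case: eqVneq => [e|]; last by rewrite andbF.
    by rewrite (subb_anti BC) ?eqxx // e in nB.
  rewrite subb_refl sub eqxx /= !addbF andbT.
  by case E: (C x) => //=; rewrite (subbP _ _ sub).
rewrite e big1_seq // => B _; apply/negP => /andP[Bx].
case: (boolP (subb B C)) => //= /subbP/(_ x Bx) Cx.
case: (boolP (subb B C')) => //= [/subbP/(_ x Bx) C'x|]; first by rewrite Cx C'x in e.
by rewrite andbF.
Qed.

(** Both sides are bilinear in [R] and [R'], which reduces the identity to a pair of balls. *)
Lemma xors_product R R' F x : (forall C, C \in R -> BB C) ->
  (forall C, C \in R' -> BB C) -> uniq F -> {subset R <= F} -> {subset R' <= F} ->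
  \big[addb/false]_(B <- F) (B x && ((above R B && above R' B) (+)
     (sabove R B && sabove R' B))) = xors R x && xors R' x.
Proof.
move=> hR hR' uF sR sR'.
transitivity (\big[addb/false]_(B <- F) \big[addb/false]_(C <- R)
  \big[addb/false]_(C' <- R') (B x && ((subb B C && subb B C') (+)
     ((subb B C && (B != C)) && (subb B C' && (B != C')))))).
  apply: eq_bigr => B _; rewrite /above /sabove !big_distrlr -big_split big_distrr /=.
  apply: eq_bigr => C _; rewrite -big_split big_distrr /=.
  by apply: eq_bigr.
rewrite exchange_big /= /xors big_distrlr /=; apply: eq_big_seq => C CR.
rewrite exchange_big /=; apply: eq_big_seq => C' CR'.
by rewrite smaller_of_two //; [exact: sR | exact: sR' | exact: hR | exact: hR'].
Qed.

Lemma xors_repr_merge v D R R' : uniq R -> uniq R' -> xors_repr D R -> xors_repr D R' ->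
  xors_repr D (merge v R R').
Proof.
move=> uR uR' [RB RD] [RB' RD']; split=> [C|x].
  by rewrite mem_filter mem_undup mem_cat => /andP[_ /orP[/RB|/RB']].
rewrite xors_filter; set F := undup _.
have uF : uniq F by apply: undup_uniq.
have sR : {subset R <= F} by move=> C h; rewrite mem_undup mem_cat h.
have sR' : {subset R' <= F} by move=> C h; rewrite mem_undup mem_cat h orbT.
have P := xors_product x RB RB' uF sR sR'.
(* Both lists represent [D], so the meet represents [D && D], and the join, which is [a + b + ab]
   modulo 2, represents [D + D + D]; both are [D]. *)
rewrite RD RD' andbb in P.
case: v; first by rewrite -[RHS]P; apply: eq_bigr => B _; apply: andbC.
transitivity (\big[addb/false]_(B <- F) (((B \in R) && B x (+) (B \in R') && B x)
   (+) (B x && ((above R B && above R' B) (+) (sabove R B && sabove R' B))))).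
  apply: eq_bigr => B _; rewrite /opv !aboveE //.
  by case: (B x) (sabove R B) (sabove R' B) (B \in R) (B \in R') => [] [] [] [] [].
by rewrite 2!big_split /= P !big_mem // -/(xors R x) -/(xors R' x) RD RD' addbb.
Qed.

Lemma size_mem R F : uniq R -> uniq F -> {subset R <= F} ->
  size R = \sum_(B <- F) (B \in R).
Proof.
move=> uR uF sub; rewrite -big_mkcond /= sum1_count -size_filter.
apply/perm_size; apply: uniq_perm => //; first exact: filter_uniq.
by move=> B; rewrite mem_filter; case: (boolP (B \in R)) => // /sub ->.
Qed.

(** Submodularity holds ball by ball: it is a finite check over the two memberships and the two
    values just outside the ball. *)
Lemma size_merge R R' : uniq R -> uniq R' ->
  size (merge true R R') + size (merge false R R') <= size R + size R'.
Proof.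
move=> uR uR'; set F := undup (R ++ R').
have uF : uniq F by apply: undup_uniq.
rewrite (@size_mem R F) // ?(@size_mem R' F) //; first last.
- by move=> C h; rewrite mem_undup mem_cat h.
- by move=> C h; rewrite mem_undup mem_cat h orbT.
rewrite /merge !size_filter -!sum1_count !(big_mkcond (fun B => _ (+) _)) /=.
rewrite -!big_split /=; apply: leq_sum => B _; rewrite /opv !aboveE //.
by case: (sabove R B) (sabove R' B) (B \in R) (B \in R') => [] [] [] [].
Qed.

(** The two merges together have at most twice the minimal number of balls, and neither can have
    fewer than the minimum. *)
Lemma minrep_merge v D R R' : minrep D R -> minrep D R' -> minrep D (merge v R R').
Proof.
move=> mR mR'; have [uR uR'] := (minrep_uniq mR, minrep_uniq mR').
have [[rR minR] [rR' minR']] := (mR, mR').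
split=> [|R'' rR'']; first exact: xors_repr_merge.
have := size_merge uR uR'; have := minR' _ (xors_repr_merge (~~ v) uR uR' rR rR').
have := minR _ rR''; have := minR' _ rR.
by case: v => /=; lia.
Qed.

Lemma minrep_size D R R' : minrep D R -> minrep D R' -> size R = size R'.
Proof. by move=> [r m] [r' m']; apply/eqP; rewrite eqn_leq m // m'. Qed.

Lemma exists_minimal R : R != [::] ->
  exists2 E, E \in R & forall C, C \in R -> subb C E -> C = E.
Proof.
elim: R => // B R IH _; have [->|/IH[E ER Emin]] := eqVneq R [::].
  by exists B; rewrite ?mem_head // => C; rewrite inE => /eqP.
have [BE|nBE] := boolP (subb B E).
  exists B; rewrite ?mem_head // => C; rewrite inE => /orP[/eqP //|CR] CB.
  have CE : C = E by apply: Emin => //; apply/subbP => x /(subbP _ _ CB)/(subbP _ _ BE).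
  by subst C; apply: subb_anti.
exists E; first by rewrite inE ER orbT.
by move=> C; rewrite inE => /orP[/eqP -> h|]; [rewrite h in nBE | exact: Emin].
Qed.

(** By minimality, a ball of [R] that meets [E] contains it. *)
Lemma above_minimal D R E x : minrep D R -> E \in R ->
  (forall C, C \in R -> subb C E -> C = E) -> E x -> D x = above R E.
Proof.
move=> [[RB RD] _] ER Emin Ex; rewrite -RD; apply: eq_big_seq => C CR.
apply/idP/idP => [Cx|/subbP]; last exact.
have [/Emin -> //|//|h] := BBlam (RB _ CR) (RB _ ER); first exact: subb_refl.
by case: (h x).
Qed.

(* Otherwise trading the balls of [R] inside [E] for [E] itself, or dropping
   [E], would shorten [R]. *)
Lemma above_const v D R E : minrep D R -> BB E -> (exists x, E x) ->
  (forall x, E x -> D x = v) -> above R E = v.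
Proof.
move=> mR BE [x0 Ex0] Dv; apply: contrapT => nv.
have {nv} nv : above R E = ~~ v by case: v (above R E) nv {Dv} => [] [].
have uR := minrep_uniq mR; have [[RB RD] min] := mR.
pose p C := subb C E && (C != E).
pose R1 := [seq C <- R | ~~ p C]; pose R2 := [seq C <- R | p C].
have R12 x : xors R1 x (+) xors R2 x = D x.
  rewrite -RD !xors_filter /xors -big_split /=.
  by apply: eq_bigr => C _; case: (p C); rewrite /= ?addbF.
have sz : size R1 + size R2 = size R by rewrite !size_filter addnC count_predC.
have in1 x : E x -> xors R1 x = ~~ v.
  move=> Ex; rewrite xors_filter -nv; apply: eq_big_seq => C CR.
  apply/andP/idP => [[npC Cx]|EC]; last first.
    split; last exact: (subbP _ _ EC).
    by apply/negP => /andP[CE]; rewrite (subb_anti CE EC) eqxx.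
  have [CE|//|h] := BBlam (RB _ CR) BE; last by case: (h x).
  move: npC; rewrite /p CE negbK => /eqP ->; exact: subb_refl.
have out2 x : ~~ E x -> xors R2 x = false.
  move=> nEx; rewrite xors_filter big1 // => C _.
  by apply/negP => /andP[/andP[/subbP h _] /h Ex]; rewrite Ex in nEx.
have one x : xors (E :: R1) x = D x.
  rewrite xors_cons; have [Ex|nEx] := boolP (E x); first by rewrite in1 ?Dv //; case: (v).
  by rewrite -R12 out2 ?addbF.
have BB1 C : C \in R1 -> BB C by rewrite mem_filter => /andP[_ /RB].
have [ER|nER] := boolP (E \in R).
  have ER1 : E \in R1 by rewrite mem_filter /p eqxx andbF.
  have := min (rem E R1); rewrite size_rem //.
  have /[swap]/[apply] : xors_repr D (rem E R1).
    split=> [C /mem_rem/BB1 //|x].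
    rewrite -one -[RHS](@addKb (E x)) xors_cons.
    by rewrite (xors_perm x (perm_to_rem ER1)) xors_cons; case: (E x); rewrite /= ?negbK.
  by case: (R1) ER1 sz => // a l _ <-; rewrite /= addSn => le; have := leq_addr (size R2) (size l); lia.
(* When [E] is not in [R] the trade adds one ball, so minimality leaves at most one ball in [R2], a
   proper part of [E]. A point of [E] outside it gives the contradiction. *)
have le : size R2 <= 1.
  have /min : xors_repr D (E :: R1).
    by split=> // C; rewrite inE => /orP[/eqP -> //|]; apply: BB1.
  by rewrite /= -sz -[X in _ <= X]addn1 leq_add2l.
have [x Ex x2] : exists2 x, E x & xors R2 x = false.
  have R2p C : C \in R2 -> p C by rewrite mem_filter => /andP[].
  case: R2 le R2p {R12 sz out2} => [|G [|//]] _ R2p.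
    by exists x0 => //; rewrite /xors big_nil.
  have /andP[GE ne] := R2p G (mem_head _ _).
  have /existsNP[x /not_implyP[Ex nGx]] : ~ forall x, E x -> G x.
    by move=> h; move/eqP: ne; apply; apply: subb_anti => //; apply/subbP.
  by exists x => //; rewrite xors_cons /xors big_nil addbF; apply/negP.
by have := R12 x; rewrite x2 in1 // Dv //; case: (v).
Qed.

Definition leaf v D E := exists R, [/\ minrep D R, E \in R,
  forall x, E x -> D x = v & forall C, C \in R -> subb C E -> C = E].

(** Merging with [v] keeps every leaf of value [v] present in either list: by [above_const] its
    value is [v] in both, while in a list containing it the value just outside is the opposite one,
    which is absorbing for [opv v]. *)
Lemma leaves_together v D es : es != [::] ->
  (forall E, E \in es -> leaf v D E) ->
  exists2 R, minrep D R & {subset es <= R}.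
Proof.
elim: es => // E es IH _ lf.
have [R' [mR' ER' _ _]] := lf E (mem_head _ _).
have [->|/IH[C Ces|R mR sub]] := eqVneq es [::].
- by exists R' => // C; rewrite inE => /eqP ->.
- by apply: lf; rewrite inE Ces orbT.
exists (merge v R R'); first exact: minrep_merge.
move=> C Ces; have [R'' [mR'' CR'' Cv _]] := lf C Ces.
have BC : BB C by apply: mR''.1.1.
have C0 := minrep_mem mR'' CR''.
have aR := above_const mR BC C0 Cv; have aR' := above_const mR' BC C0 Cv.
have CRR' : (C \in R) || (C \in R').
  by move: Ces; rewrite inE => /orP[/eqP ->|/sub ->]; rewrite ?ER' ?orbT.
rewrite mem_filter mem_undup mem_cat CRR' andbT aR aR'.
move: (aboveE C (minrep_uniq mR)) (aboveE C (minrep_uniq mR')) CRR'.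
rewrite aR aR' /opv; case: (v) (sabove R C) (sabove R' C) (C \in R) (C \in R').
  by case=> [] [] [] [].
by case=> [] [] [] [].
Qed.

Lemma bounded_enum (T : eqType) (P : T -> Prop) j :
  (forall es, uniq es -> (forall e, e \in es -> P e) -> size es <= j) ->
  exists2 L : seq T, size L <= j & forall e, P e -> e \in L.
Proof.
move=> bd; suff H d es : uniq es -> (forall e, e \in es -> P e) ->
    j - size es <= d -> exists2 L : seq T, size L <= j & forall e, P e -> e \in L.
  by apply: (H j [::]); rewrite ?subn0.
elim: d es => [|d IH] es ues hes; have le := bd _ ues hes.
  move=> le'; exists es => // e Pe; apply: contraT => ne.
  have := bd (e :: es); rewrite /= ne => /(_ ues)/(_ _).
  have /[swap]/[apply] : forall e', e' \in e :: es -> P e'.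
    by move=> e'; rewrite inE => /orP[/eqP ->|/hes].
  by lia.
move=> le'; have [[e Pe ne]|no] := pselect (exists2 e, P e & e \notin es).
  apply: (IH (e :: es)); rewrite /= ?ne //; last by lia.
  by move=> e'; rewrite inE => /orP[/eqP ->|/hes].
by exists es => // e Pe; apply: contraT => ne; case: no; exists e.
Qed.

(** The factor [2 * j] bounds the leaves of both values; the other balls occur beside a leaf, in
    representations with one ball fewer. *)
Fixpoint occ_bound j := if j is j'.+1 then (2 * j) * (1 + occ_bound j') else 0.

Lemma minrep_rem D R E : minrep D R -> E \in R ->
  minrep (fun x => D x (+) E x) (rem E R).
Proof.
move=> [[RB RD] min] ER; split.
  split=> [C /mem_rem/RB //|x].
  by rewrite -RD (xors_perm x (perm_to_rem ER)) xors_cons addbC addKb.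
move=> R' [RB' RD']; rewrite size_rem //.
have : xors_repr D (E :: R').
  split=> [C|x]; first by rewrite inE => /orP[/eqP ->|/RB' //]; apply: RB.
  by rewrite xors_cons RD' addbCA addbb addbF.
by move/min => /=; case: (size R).
Qed.

(** Every nonempty minimal representation has an inclusion-minimal ball, which is a leaf for one of
    the two values. Leaves of one value fit into a single minimal representation, so there are at
    most [size R0] of them. Removing a leaf [E] leaves a minimal representation of the sum of [D]
    and [E], to which the induction applies. *)
Lemma occ_finite D R0 : minrep D R0 -> exists2 F, size F <= occ_bound (size R0) &
  forall R B, minrep D R -> B \in R -> B \in F.
Proof.
move Ej : (size R0) => j; elim: j => [|j IH] in D R0 Ej * => m0.
  by exists [::] => // R B /(minrep_size m0); rewrite Ej; case: R.
have leaves v : exists2 L, size L <= j.+1 & forall E, leaf v D E -> E \in L.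
  apply: bounded_enum => es ues lf; have [->//|es0] := eqVneq es [::].
  have [R mR sub] := leaves_together es0 lf.
  by rewrite -Ej (minrep_size m0 mR); apply: uniq_leq_size.
have [[L1 s1 H1] [L0 s0 H0]] := (leaves true, leaves false).
have /boolp.choice[FE FEP] (E : U -> bool) : exists F,
    size F <= occ_bound j /\ forall R B, minrep D R -> E \in R ->
       B \in rem E R -> B \in F.
  have [[R mR ER]|no] := pselect (exists2 R, minrep D R & E \in R); last first.
    by exists [::]; split=> // R B mR ER; case: no; exists R.
  have [|F sF HF] := IH _ (rem E R) _ (minrep_rem mR ER).
    by rewrite size_rem // -(minrep_size m0 mR) Ej.
  exists F; split=> // R' B mR' ER' BR'.
  by apply: HF (minrep_rem mR' ER') BR'.
exists ((L1 ++ L0) ++ flatten [seq FE E | E <- L1 ++ L0]).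
  rewrite size_cat size_flatten.
  have le L : sumn (shape [seq FE E | E <- L]) <= size L * occ_bound j.
    elim: L => //= E L le; rewrite mulSn leq_add //; exact: (FEP E).1.
  have := le (L1 ++ L0); have : size (L1 ++ L0) <= 2 * j.+1 by rewrite size_cat; lia.
  by move: (size (L1 ++ L0)) (sumn _) => a b /=; nia.
move=> R B mR BR; have [|E ER Emin] := @exists_minimal R; first by case: (R) BR.
have EL : E \in L1 ++ L0.
  have lf : leaf (above R E) D E.
    by exists R; split=> // x; apply: above_minimal.
  by rewrite mem_cat; case: (above R E) lf => [/H1|/H0] ->; rewrite ?orbT.
have [<-|ne] := eqVneq E B; first by rewrite mem_cat EL.
rewrite mem_cat; apply/orP; right; apply/flattenP; exists (FE E).
  by apply/mapP; exists E.
apply: ((FEP E).2 R B mR ER); rewrite (rem_filter _ (minrep_uniq mR)).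
by rewrite mem_filter /= eq_sym ne.
Qed.

End Laminar.

(** * Convex orderings *)

Section ConvexOrder.
Variable U : Type.
Implicit Types (B C D E : U -> bool) (s : seq U).

Definition changes (V : eqType) (f : U -> V) x s :=
  adjs (fun x y => f x != f y) x s.

Lemma changes_cat (V : eqType) (f : U -> V) x s y t :
  changes f x (s ++ y :: t) <= changes f x s + 1 + changes f y t.
Proof.
rewrite /changes; elim: s x => [|z s IH] x /=.
  by rewrite add0n leq_add2r leq_b1.
by rewrite -!addnA leq_add2l addnA.
Qed.

Lemma changes_const (V : eqType) (f : U -> V) c x s :
  all (fun x => f x == c) (x :: s) -> changes f x s = 0.
Proof.
rewrite /changes; elim: s x => //= y s IH x /and3P[/eqP fx /eqP fy h].
by rewrite fx fy eqxx add0n IH //= fy eqxx.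
Qed.

Definition convex B s := exists u v w, [/\ s = u ++ v ++ w,
  all (fun x => B x == false) u, all (fun x => B x == true) v &
  all (fun x => B x == false) w].

Lemma changes_cat2 (V : eqType) (f : U -> V) c k s t :
  all (fun x => f x == c) s -> (forall x t', t = x :: t' -> changes f x t' <= k) ->
  forall x r, s ++ t = x :: r -> changes f x r <= k.+1.
Proof.
case: s => [|y s] /= hs ht x r; first by move=> /ht /leqW.
case=> <- <-; case: t ht => [|z t] ht.
  by rewrite cats0 (changes_const hs).
by apply: leq_trans (changes_cat _ _ _ _ _) _; rewrite (changes_const hs) add0n add1n ltnS ht.
Qed.

Lemma convex_changes B s x r : convex B s -> s = x :: r -> changes B x r <= 2.
Proof.
case=> u [v [w [-> hu hv hw]]].
apply: changes_cat2 hu _ _ _ => {}x {}r; apply: changes_cat2 hv _ _ _.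
by move=> {}x {}r e; rewrite (@changes_const _ _ false) // -e.
Qed.

Lemma changes_xors (R : seq (U -> bool)) k x s :
  (forall C, C \in R -> changes C x s <= k) -> changes (xors R) x s <= size R * k.
Proof.
rewrite /changes => h.
apply: leq_trans (_ : \sum_(C <- R) adjs (fun x y => C x != C y : nat) x s <= _).
  rewrite -adjs_sum; apply: adjs_le => y z; rewrite /xors.
  elim: R {h} => [|C R IH]; first by rewrite !big_nil.
  rewrite !big_cons; apply: leq_trans (_ : (C y != C z) + (xors R y != xors R z) <= _).
    by rewrite /xors; case: (C y) (C z) (\big[_/_]_(i <- _) _) (\big[_/_]_(i <- _) _) => [] [] [] [].
  by rewrite leq_add2l.
rewrite -sum1_size big_distrl /= big_seq [leqRHS]big_seq.
by apply: leq_sum => C CR; rewrite mul1n h.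
Qed.

Variable BB : (U -> bool) -> Prop.
Hypothesis BBlam : laminar BB.

(* The balls of a laminar family can be listed depth first; splitting off a
   maximal proper trace gives the same order without choosing a tree. *)
Lemma convex_order s : exists s', [/\ size s' = size s,
  (forall p : pred U, all p s' = all p s) & forall B, BB B -> convex B s'].
Proof.
have [n] := ubnP (size s); elim: n s => // n IH s; rewrite ltnS => sn.
pose proper B := 0 < count B s < size s.
have [[B0 BB0 prop0]|no] := pselect (exists2 B, BB B & proper B); last first.
  exists s; split=> // B BBB; have := count_size B s; rewrite leq_eqVlt.
  case/orP => [/eqP e|lt].
    exists [::], s, [::]; rewrite cats0; split=> //.
    by rewrite (eq_all (a2 := B)) ?all_count ?e ?eqxx // => x; apply: eqb_id.
  exists s, [::], [::]; rewrite !cats0; split=> //.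
  rewrite (eq_all (a2 := predC B)) => [|x /=]; last by case: (B x).
  rewrite all_predC has_count; apply/negP => gt; apply: no; exists B => //.
  by rewrite /proper gt.
(* A proper trace of greatest size exists because these sizes are below [size s]. *)
have [B [BBB /andP[B0s Bss] Bmax]] : exists B, [/\ BB B, proper B &
    forall C, BB C -> proper C -> count C s <= count B s].
  apply: contrapT => nex; have H k : exists2 B, BB B & proper B && (k <= count B s).
    elim: k => [|k [B BBB /andP[pB kB]]]; first by exists B0; rewrite ?prop0.
    apply: contrapT => nC; apply: nex; exists B; split=> // C BBC pC.
    rewrite leqNgt; apply/negP => lt; apply: nC; exists C; rewrite ?pC //.
    exact: leq_ltn_trans lt.
  have [B _ /andP[/andP[_ lt]]] := H (size s).
  by rewrite leqNgt lt.
have [|s1 [z1 m1 c1]] := IH (filter B s).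
  by rewrite size_filter; apply: leq_trans sn.
have [|s2 [z2 m2 c2]] := IH (filter (predC B) s).
  by rewrite size_filter; have := count_predC B s; move: sn; lia.
have B1 : all B s1 by rewrite m1 filter_all.
have B2 : all (predC B) s2 by rewrite m2 filter_all.
have m12 p : all p (s1 ++ s2) = all p s.
  rewrite all_cat m1 m2 !all_filter -all_predI.
  by apply: eq_all => x /=; case: (B x); rewrite /= ?andbT.
exists (s1 ++ s2); split=> //.
  by rewrite size_cat z1 z2 !size_filter count_predC.
move=> C BBC; have sub12 (l : seq U) (p q : pred U) :
    all p l -> (forall x, p x -> q x) -> all q l.
  by move=> h imp; apply: sub_all h.
have [/subbP CB|/subbP BC|dis] := BBlam BBC BBB.
- have [u [v [w [-> hu hv hw]]]] := c1 _ BBC.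
  exists u, v, (w ++ s2); split; rewrite ?catA // all_cat hw /=.
  by apply: sub12 B2 _ => x /= nB; rewrite eqbF_neg; apply: contra nB; apply: CB.
(* By maximality, a ball containing [B] has either the same trace as [B] or the whole list as its
   trace. *)
- have cnt : count C s = count B s + count (fun x => C x && ~~ B x) s.
    elim: (s) => //= x l ->; have := BC x.
    by case: (B x) (C x) => [] [] // h; rewrite ?add0n ?addn0 //; first [lia | have := h isT].
  have [pC|npC] := boolP (proper C).
    exists [::], s1, s2; split=> //=; first by apply: sub12 B1 _ => x /BC ->.
    rewrite m2 all_filter; have := Bmax C BBC pC.
    rewrite cnt -[X in _ <= X]addn0 leq_add2l leqNgt -has_count -all_predC.
    by apply: sub_all => x /=; case: (C x) (B x) => [] [].
  exists [::], (s1 ++ s2), [::]; rewrite cats0; split=> //.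
  rewrite m12 (eq_all (a2 := C)) => [|x]; last exact: eqb_id.
  move: npC; rewrite all_count /proper cnt ltn_addr //= -leqNgt => le.
  by rewrite eqn_leq le andbT -cnt count_size.
have [u [v [w [e hu hv hw]]]] := c2 _ BBC.
exists (s1 ++ u), v, w; split; rewrite ?e ?catA // all_cat hu andbT.
by apply: sub12 B1 _ => x Bx; rewrite eqbF_neg; apply/negP => Cx; apply: (dis x).
Qed.

End ConvexOrder.

From mathcomp Require Import classical_sets functions cardinality.

Local Open Scope card_scope.
Local Open Scope classical_set_scope.

(** * Definable predicates *)

Section Definable.
Variables (L : language) (U : structure L).

(* [C] lists the functions that may be substituted for the variables. *)
Definition dfnC (G : Type) (C : set (G -> U)) (P : G -> Prop) : Prop :=
  exists m (f : formula L m) (t : 'I_m -> G -> U), (forall i, C (t i)) /\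
    forall g, P g <-> holds f [tuple t i g | i < m].

Definition prodC (G H : Type) (C : set (G -> U)) (C' : set (H -> U)) :
    set (G * H -> U) :=
  [set c | (exists2 c0, C c0 & c = c0 \o fst) \/ (exists2 c1, C' c1 & c = c1 \o snd)].

(* A sort of elements with finitely many coordinates in [U] each, over which
   definable predicates may be quantified. *)
Record ctx := Ctx {
  csort :> Type;
  coord : set (csort -> U);
  ctx_ex : forall (G : Type) (C : set (G -> U)) (P : G * csort -> Prop),
    dfnC (prodC C coord) P -> dfnC C (fun g => exists h, P (g, h)) }.

Definition dfn (G : ctx) (P : G -> Prop) := dfnC (@coord G) P.

Section Closure.
Variables (G : Type) (C : set (G -> U)).
Implicit Types P Q : G -> Prop.

Lemma dfnC_ext P Q : (forall g, P g <-> Q g) -> dfnC C P -> dfnC C Q.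
Proof.
move=> e [m [f [t [Ct h]]]]; exists m, f, t; split=> // g.
by rewrite -e.
Qed.

Lemma dfnC_false : dfnC C (fun=> False).
Proof.
exists 0, Bot, (fun i : 'I_0 => match i with Ordinal m h => match notF h with end end).
by split=> [[]|].
Qed.

Lemma dfnC_not P : dfnC C P -> dfnC C (fun g => ~ P g).
Proof.
move=> [m [f [t [Ct h]]]]; exists m, (Neg f), t; split=> // g /=.
by rewrite h.
Qed.

Lemma dfnC_and P Q : dfnC C P -> dfnC C Q -> dfnC C (fun g => P g /\ Q g).
Proof.
move=> [m [f [t [Ct h]]]] [m' [f' [t' [Ct' h']]]].
pose u (i : 'I_(m + m')) := match fintype.split i with inl j => t j | inr j => t' j end.
exists (m + m'), (And (rename f (lshift m')) (rename f' (@rshift m m'))), u.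
split=> [i|g /=]; first by rewrite /u; case: fintype.split.
rewrite !holds_rename h h'.
suff [-> ->] : [tuple tnth [tuple u i g | i < m + m'] (lshift m' i) | i < m] =
    [tuple t i g | i < m] /\
    [tuple tnth [tuple u i g | i < m + m'] (rshift m i) | i < m'] =
    [tuple t' i g | i < m'] by [].
split; apply: eq_from_tnth => i; rewrite !tnth_mktuple /u.
  by rewrite (unsplitK (inl _ i)).
by rewrite (unsplitK (inr _ i)).
Qed.

Lemma dfnC_eq c c' : C c -> C c' -> dfnC C (fun g => c g = c' g).
Proof.
move=> Cc Cc'; exists 2, (Eq (Var ord0) (Var ord_max)).
exists (fun i => if i == ord0 then c else c'); split=> [i|g /=].
  by case: ifP.
by rewrite !tnth_mktuple.
Qed.

Lemma dfnC_sub (G' : Type) (C' : set (G' -> U)) (r : G -> G') (P : G' -> Prop) :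
  (forall c, C' c -> C (c \o r)) -> dfnC C' P -> dfnC C (P \o r).
Proof.
move=> sub [m [f [t [Ct h]]]]; exists m, f, (fun i => t i \o r).
by split=> [i|g]; [exact: sub | exact: h].
Qed.

Lemma dfnC_ex1 (P : G * U -> Prop) :
  dfnC (prodC C [set id]) P -> dfnC C (fun g => exists u, P (g, u)).
Proof.
move=> [m [f [t [Ct h]]]].
have /boolp.choice[c0 Cc0] (i : 'I_m) : exists o, match o with
    | Some c => C c /\ t i = c \o fst
    | None => t i = snd end.
  have [[c Cc e]|[_ -> e]] := Ct i; first by exists (Some c).
  by exists None.
(* If [C] is empty, no function can be substituted for a free variable, so the formula is built
   without free variables. *)
have [[d Cd]|noC] := pselect (exists d, C d); last first.
  have all_none i : t i = snd.
    by have := Cc0 i; case: (c0 _) => // d [Cd _]; case: noC; exists d.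
  exists 0, (Ex (rename f (fun=> ord0 : 'I_1))).
  exists (fun i : 'I_0 => match i with Ordinal m h => match notF h with end end).
  split=> [[] //|g /=].
  split=> -[u]; rewrite ?h => hu; exists u; move: hu; rewrite ?h holds_rename;
    congr holds; apply: eq_from_tnth => i; rewrite !tnth_mktuple all_none.
    by rewrite tnth0.
  by rewrite tnth0.
pose r (i : 'I_m) : 'I_m.+1 := if c0 i is Some _ then lift ord0 i else ord0.
exists m, (Ex (rename f r)), (fun i => odflt d (c0 i)).
split=> [i|g /=].
  by have := Cc0 i; case: (c0 _) => [c [] |].
have E u : [tuple t i (g, u) | i < m] =
  [tuple tnth [tuple of u :: [tuple odflt d (c0 i) g | i < m]] (r i) | i < m].
  apply: eq_from_tnth => i; rewrite !tnth_mktuple /r.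
  have := Cc0 i; case ci: (c0 _) => [c|].
    by move=> [_ ->] /=; rewrite tnthS tnth_mktuple ci.
  by move=> ->; rewrite tnth0.
by split=> -[u hu]; exists u; [apply/holds_rename; rewrite -E; apply/h |
  apply/h; rewrite E; apply/holds_rename].
Qed.

Lemma dfnC_or P Q : dfnC C P -> dfnC C Q -> dfnC C (fun g => P g \/ Q g).
Proof.
move=> dP dQ; apply: dfnC_ext (dfnC_not (dfnC_and (dfnC_not dP) (dfnC_not dQ))).
by move=> g; have := pselect (P g); have := pselect (Q g); tauto.
Qed.

Lemma dfnC_imp P Q : dfnC C P -> dfnC C Q -> dfnC C (fun g => P g -> Q g).
Proof.
move=> dP dQ; apply: dfnC_ext (dfnC_or (dfnC_not dP) dQ) => g.
by have := pselect (P g); tauto.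
Qed.

Lemma dfnC_iff P Q : dfnC C P -> dfnC C Q -> dfnC C (fun g => P g <-> Q g).
Proof. by move=> dP dQ; apply: dfnC_and; apply: dfnC_imp. Qed.

Lemma dfnC_const (p : Prop) : dfnC C (fun=> p).
Proof.
have [hp|np] := pselect p; last by apply: dfnC_ext dfnC_false => g; tauto.
by apply: dfnC_ext (dfnC_not dfnC_false) => g; tauto.
Qed.

Lemma dfnC_eqb (Q : G -> bool) b : dfnC C Q -> dfnC C (fun g => Q g = b).
Proof.
move=> dQ; case: b; first exact: dfnC_ext dQ.
by apply: dfnC_ext (dfnC_not dQ) => g; split=> [/negP/negbTE|->].
Qed.

Lemma dfnC_bigex (I : finType) (Q : I -> G -> Prop) :
  (forall i, dfnC C (Q i)) -> dfnC C (fun g => exists i, Q i g).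
Proof.
move=> dQ; suff H (r : seq I) : dfnC C (fun g => exists2 i, i \in r & Q i g).
  apply: dfnC_ext (H (enum I)) => g.
  by split=> [[i]|[i Qi]]; exists i; rewrite ?mem_enum.
elim: r => [|j r IH]; first by apply: dfnC_ext dfnC_false => g; split=> // -[].
apply: dfnC_ext (dfnC_or (dQ j) IH) => g; split=> [[Qj|[i ir Qi]]|[i]].
- by exists j; rewrite ?mem_head.
- by exists i; rewrite // inE ir orbT.
- by rewrite inE => /orP[/eqP ->|ir Qi]; [left | right; exists i].
Qed.

Lemma dfnC_bigall (I : finType) (Q : I -> G -> Prop) :
  (forall i, dfnC C (Q i)) -> dfnC C (fun g => forall i, Q i g).
Proof.
move=> dQ; apply: dfnC_ext (dfnC_not (dfnC_bigex (fun i => dfnC_not (dQ i)))) => g.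
by split=> [no i|h [i]]; [apply: contrapT => nQ; apply: no; exists i | apply].
Qed.

Lemma dfnC_xor (I : Type) (r : seq I) (Q : I -> G -> bool) :
  (forall i, dfnC C (Q i)) -> dfnC C (fun g => \big[addb/false]_(i <- r) Q i g).
Proof.
move=> dQ; elim: r => [|i r IH].
  by apply: dfnC_ext dfnC_false => g; rewrite big_nil.
apply: dfnC_ext (dfnC_not (dfnC_iff (dQ i) IH)) => g; rewrite big_cons.
have aux (a b : bool) : ~ (a <-> b) <-> a (+) b.
  case: a; case: b; split=> //= h; try by exfalso; apply: h.
  - by case=> /(_ isT).
  - by case=> _ /(_ isT).
exact: aux.
Qed.

End Closure.

Lemma dfnC_exprod (H : ctx) (G : Type) (C : set (G -> U)) (P : G -> H -> Prop) :
  dfnC (prodC C (@coord H)) (fun gh => P gh.1 gh.2) ->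
  dfnC C (fun g => exists h, P g h).
Proof. exact: (@ctx_ex H G C (fun gh => P gh.1 gh.2)). Qed.

Definition ctxU : ctx := Ctx (@dfnC_ex1).

Lemma ctx1_ex (G : Type) (C : set (G -> U)) (P : G * unit -> Prop) :
  dfnC (prodC C set0) P -> dfnC C (fun g => exists h, P (g, h)).
Proof.
move=> dP; apply: (@dfnC_ext _ _ (P \o (fun g => (g, tt)))).
  by move=> g; split=> [h|[[] //]]; exists tt.
by apply: dfnC_sub dP => c [[c0 C0 ->]|[]].
Qed.

Definition ctx1 : ctx := Ctx ctx1_ex.

Lemma ctxX_ex (H1 H2 : ctx) (G : Type) (C : set (G -> U))
    (P : G * (H1 * H2) -> Prop) :
  dfnC (prodC C (prodC (@coord H1) (@coord H2))) P ->
  dfnC C (fun g => exists h, P (g, h)).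
Proof.
move=> dP.
apply: (@dfnC_ext _ _ (fun g => exists h1, exists h2, P (g, (h1, h2)))).
  by move=> g; split=> [[h1 [h2 h]]|[[h1 h2] h]]; [exists (h1, h2) | exists h1, h2].
apply: dfnC_exprod; apply: (@dfnC_exprod H2 _ _ (fun gh h2 => P (gh.1, (gh.2, h2)))).
apply: (dfnC_sub (r := fun ghh : G * H1 * H2 => (ghh.1.1, (ghh.1.2, ghh.2)))) dP => c.
case=> [[c0 C0 ->]|[_ [[c1 C1 ->]|[c1 C1 ->]] ->]].
- by left; exists (c0 \o fst) => //; left; exists c0.
- by left; exists (c1 \o snd) => //; right; exists c1.
- by right; exists c1.
Qed.

Definition ctxX (H1 H2 : ctx) : ctx := Ctx (@ctxX_ex H1 H2).

Definition tuple_coord j (H : ctx) : set (j.-tuple H -> U) :=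
  [set c | exists i, exists2 d, coord d & c = d \o (fun t => tnth t i)].

Lemma ctxT_ex j (H : ctx) (G : Type) (C : set (G -> U))
    (P : G * j.-tuple H -> Prop) :
  dfnC (prodC C (tuple_coord (H := H))) P -> dfnC C (fun g => exists h, P (g, h)).
Proof.
elim: j => [|j IH] in G C P * => dP.
  apply: (@dfnC_ext _ _ (P \o (fun g => (g, [tuple])))).
    by move=> g; split=> [h|[t]]; [exists [tuple] | rewrite tuple0].
  by apply: dfnC_sub dP => c [[c0 C0 ->] //|[c1 [i _] _]]; case: i.
apply: (@dfnC_ext _ _ (fun g => exists h : H, exists t : j.-tuple H,
    P (g, [tuple of h :: t]))).
  move=> g; split=> [[h [t ht]]|[t]]; first by exists [tuple of h :: t].
  by move=> ht; exists (thead t), [tuple of behead t]; rewrite -tuple_eta.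
apply: dfnC_exprod.
apply: (IH _ _ (fun gt : G * H * j.-tuple H => P (gt.1.1, [tuple of gt.1.2 :: gt.2]))).
apply: (dfnC_sub (r := fun gt : G * H * j.-tuple H =>
  (gt.1.1, [tuple of gt.1.2 :: gt.2]))) dP => c.
case=> [[c0 C0 ->]|[_ [i [d Cd ->]] ->]].
  by left; exists (c0 \o fst) => //; left; exists c0.
have [k ->|->] := unliftP ord0 i.
  right; exists (d \o (fun t => tnth t k)); first by exists k, d.
  by apply: funext => -[[g h] t] /=; rewrite tnthS.
by left; exists (d \o snd) => //; right; exists d.
Qed.

Definition ctxT j (H : ctx) : ctx := Ctx (@ctxT_ex j H).

Section Maps.
Implicit Types G H K : ctx.

(** These are the maps along which definable predicates can be pulled back. *)
Definition cmap G H (r : G -> H) := forall c, coord c -> coord (c \o r).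

Lemma cmap_comp G H K (r : G -> H) (q : H -> K) :
  cmap r -> cmap q -> cmap (fun g => q (r g)).
Proof. by move=> hr hq c Cc; apply: (hr (c \o q)); apply: hq. Qed.

Lemma cmap_fst G H : cmap (fst : ctxX G H -> G).
Proof. by move=> c Cc; left; exists c. Qed.

Lemma cmap_snd G H : cmap (snd : ctxX G H -> H).
Proof. by move=> c Cc; right; exists c. Qed.

Lemma cmap_pair G H K (r : G -> H) (q : G -> K) : cmap r -> cmap q ->
  @cmap G (ctxX H K) (fun g => (r g, q g)).
Proof. by move=> hr hq c [[d Cd ->]|[d Cd ->]]; [exact: hr | exact: hq]. Qed.

Lemma cmap_tnth G H j (r : G -> ctxT j H) i : cmap r -> @cmap G H (fun g => tnth (r g) i).
Proof. by move=> hr c Cc; apply: (hr (c \o (fun t => tnth t i))); exists i, c. Qed.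

Lemma dfn_comp G H (r : G -> H) (P : H -> Prop) : cmap r -> dfn P -> dfn (fun g => P (r g)).
Proof. by move=> hr; apply: dfnC_sub. Qed.

Lemma dfn_ex G H (P : G -> H -> Prop) :
  @dfn (ctxX G H) (fun gh => P gh.1 gh.2) -> dfn (fun g => exists h, P g h).
Proof. exact: dfnC_exprod. Qed.

Lemma dfn_all G H (P : G -> H -> Prop) :
  @dfn (ctxX G H) (fun gh => P gh.1 gh.2) -> dfn (fun g => forall h, P g h).
Proof.
move=> dP; apply: dfnC_ext (dfnC_not (dfn_ex (P := fun g h => ~ P g h) (dfnC_not dP))).
by move=> g; split=> [no h|h [k]]; [apply: contrapT => nP; apply: no; exists h | apply].
Qed.

End Maps.

End Definable.

(** * Uniform representation by balls *)

Lemma card_eq_enum (T : Type) (A : set T) n : (A #= `I_n) ->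
  exists f : 'I_n -> T, injective f /\ forall x, A x <-> exists i, f i = x.
Proof.
rewrite card_eq_sym => /card_bijP[f [g fK gK]].
pose h (i : 'I_n) : set_type `I_n := SigSub (mem_set (ltn_ord i : `I_n i)).
exists (fun i => set_val (f (h i))); split.
  move=> i j /val_inj /(can_inj fK) /(congr1 val) /= e; exact: val_inj.
move=> x; split=> [Ax|[i <-]]; last exact: set_valP.
have hi := set_valP (g (SigSub (mem_set Ax))).
exists (Ordinal hi).
have -> : h (Ordinal hi) = g (SigSub (mem_set Ax)) by apply: val_inj.
by rewrite gK.
Qed.

Section XorRepresentations.
Variable U : Type.
Variable BB : (U -> bool) -> Prop.
Hypothesis BBlam : laminar BB.

Definition xrep k (D : U -> bool) := exists2 R, size R <= k & xors_repr BB D R.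

Lemma xrep_leq k k' D : k <= k' -> xrep k D -> xrep k' D.
Proof. by move=> le [R sR rR]; exists R => //; apply: leq_trans le. Qed.

Lemma xrep_ball B : BB B -> xrep 1 B.
Proof.
move=> BBB; exists [:: B] => //; split=> [C|x]; first by rewrite inE => /eqP ->.
by rewrite xors_cons /xors big_nil addbF.
Qed.

Lemma xrep_neg k D : BB (fun=> true) -> xrep k D -> xrep k.+1 (fun x => ~~ D x).
Proof.
move=> full [R sR [RB RD]]; exists ((fun=> true) :: R) => //; split=> [C|x].
  by rewrite inE => /orP[/eqP -> //|/RB].
by rewrite xors_cons RD.
Qed.

(** By laminarity the intersection of two balls is the smaller one or empty, so the number of balls
    does not grow. *)
Lemma xrep_and_ball C k D : BB C -> xrep k D -> xrep k (fun x => C x && D x).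
Proof.
move=> BC [R sR [RB RD]].
suff [R' sR' [RB' RD']] : xrep (size R) (fun x => C x && xors R x).
  exists R'; first exact: leq_trans sR' sR.
  by split=> // x; rewrite RD' RD.
elim: R RB {sR RD} => [|E R IH] RB.
  by exists [::] => //; split=> // x; rewrite /xors !big_nil andbF.
have [|R' sR' [RB' RD']] := IH; first by move=> B BR; apply: RB; rewrite inE BR orbT.
have BE : BB E by apply: RB; rewrite mem_head.
have [/subbP CE|/subbP EC|dis] := BBlam BC BE.
- exists (C :: R') => //; split=> [B|x]; first by rewrite inE => /orP[/eqP ->|/RB'].
  rewrite !xors_cons RD'; have := CE x.
  by case: (C x) => // h; rewrite h.
- exists (E :: R') => //; split=> [B|x]; first by rewrite inE => /orP[/eqP ->|/RB'].
  rewrite !xors_cons RD'; have := EC x.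
  by case: (E x) (C x) => [] [] // h; have := h isT.
exists R'; first exact: leqW.
split=> // x; rewrite RD' xors_cons; have := dis x.
by case: (C x) (E x) => [] [] // h; case: h.
Qed.

Lemma xrep_and k k' D D' : xrep k D -> xrep k' D' ->
  xrep (k * k') (fun x => D x && D' x).
Proof.
move=> [R sR [RB RD]] x'.
suff [R' sR' [RB' RD']] : xrep (size R * k') (fun x => xors R x && D' x).
  exists R'; first by apply: leq_trans sR' _; rewrite leq_mul2r sR orbT.
  by split=> // x; rewrite RD' RD.
elim: R RB {sR RD} => [|E R IH] RB.
  by exists [::] => //; split=> // x; rewrite /xors !big_nil.
have [|R1 sR1 [RB1 RD1]] := IH; first by move=> B BR; apply: RB; rewrite inE BR orbT.
have [|R2 sR2 [RB2 RD2]] := @xrep_and_ball E _ _ _ x'; first by apply: RB; rewrite mem_head.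
exists (R2 ++ R1); first by rewrite size_cat mulSn leq_add.
split=> [B|x]; first by rewrite mem_cat => /orP[/RB2|/RB1].
rewrite xors_cat RD1 RD2 xors_cons.
by case: (E x) (xors R x) (D' x) => [] [] [].
Qed.

Lemma xrep_minrep k D : xrep k D -> exists2 R, minrep BB D R & size R <= k.
Proof.
move=> [R sR rR]; have [n] := ubnP (size R).
elim: n R sR rR => // n IH R sR rR; rewrite ltnS => sn.
have [m|nm] := pselect (minrep BB D R); first by exists R.
have [R' rR' lt] : exists2 R', xors_repr BB D R' & size R' < size R.
  apply: contrapT => no; apply: nm; split=> // R' rR'; rewrite leqNgt.
  by apply/negP => lt; apply: no; exists R'.
by apply: (IH R') => //; [apply: leq_trans (ltnW lt) sR | apply: leq_trans lt sn].
Qed.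

End XorRepresentations.

Lemma xrep_sub (U : Type) (BB BB' : (U -> bool) -> Prop) k D :
  (forall B, BB B -> BB' B) -> xrep BB k D -> xrep BB' k D.
Proof. by move=> h [R sR [RB RD]]; exists R => //; split=> // C /RB/h. Qed.

(** * Definable families of balls, uniform by compactness *)

Section Systems.
Variables (L : language) (U : structure L).
Local Notation ctx := (ctx U).
Local Notation cU := (ctxU U).

Lemma cmap_mktuple (G H : ctx) j (t : 'I_j -> G -> H) :
  (forall i, cmap (t i)) -> @cmap L U G (ctxT j H) (fun g => [tuple t i g | i < j]).
Proof.
move=> ht c [i [d Cd ->]].
rewrite (_ : _ \o _ = d \o t i); first exact: ht.
by apply: funext => g /=; rewrite tnth_mktuple.
Qed.

Lemma cmap_ext (G H : ctx) (r r' : G -> H) : (forall g, r g = r' g) -> cmap r -> cmap r'.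
Proof. by move=> /funext ->. Qed.

Lemma cmap_cat (G H : ctx) j k (r : G -> ctxT j H) (r' : G -> ctxT k H) :
  cmap r -> cmap r' -> @cmap L U G (ctxT (j + k) H) (fun g => [tuple of r g ++ r' g]).
Proof.
move=> hr hr'.
pose t (i : 'I_(j + k)) g := match fintype.split i with
  | inl a => tnth (r g) a | inr b => tnth (r' g) b end.
apply: (@cmap_ext _ (ctxT (j + k) H) (fun g => [tuple t i g | i < j + k])).
  move=> g; apply: eq_from_tnth => i; rewrite tnth_mktuple /t.
  case: splitP => a e.
    have -> : i = lshift k a by exact: val_inj.
    by rewrite tnth_lshift.
  have -> : i = rshift j a by exact: val_inj.
  by rewrite tnth_rshift.
apply: cmap_mktuple => i; rewrite /t.
by case: (fintype.split i) => a; apply: cmap_tnth.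
Qed.

Lemma cmap_tuple1 (G H : ctx) (r : G -> H) : cmap r ->
  @cmap L U G (ctxT 1 H) (fun g => [tuple r g]).
Proof.
move=> hr; apply: (@cmap_ext _ (ctxT 1 H) (fun g => [tuple r g | i < 1])).
  by move=> g; apply: eq_from_tnth => i; rewrite tnth_mktuple ord1.
exact: cmap_mktuple.
Qed.

Lemma dfn_holds (G : ctx) m (f : formula L m) (r : G -> ctxT m cU) :
  cmap r -> dfn (fun g => holds f (r g)).
Proof.
move=> hr; exists m, f, (fun i g => tnth (r g) i); split=> [i|g].
  exact: (@cmap_tnth L U G cU m r i hr id).
by rewrite (_ : [tuple tnth (r g) i | i < m] = r g) //; apply: eq_from_tnth => i;
  rewrite tnth_mktuple.
Qed.

Lemma dfn_eq (G : ctx) (r r' : G -> cU) : cmap r -> cmap r' -> dfn (fun g => r g = r' g).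
Proof.
by move=> hr hr'; apply: (@dfnC_eq _ _ _ _ r r'); [exact: (hr id) | exact: (hr' id)].
Qed.

(** The form [m + 0] is that of a formula with an empty parameter tuple, as wanted for saturation
    over the empty set. *)
Lemma dfn_formula m (Q : ctxT m cU -> Prop) : dfn Q ->
  exists psi : formula L (m + 0), forall e : m.-tuple U,
    Q e <-> holds psi [tuple of e ++ [tuple]].
Proof.
move=> [k [f [t [Ct h]]]].
have /boolp.choice[r hr] (i : 'I_k) : exists j : 'I_m, forall e : m.-tuple U, t i e = tnth e j.
  by have [j [d -> ->]] := Ct i; exists j.
exists (rename f (fun i => lshift 0 (r i))) => e; rewrite h holds_rename.
suff -> : [tuple t i e | i < k] =
   [tuple tnth [tuple of e ++ [tuple]] (lshift 0 (r i)) | i < k] by [].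
by apply: eq_from_tnth => i; rewrite !tnth_mktuple hr tnth_lshift.
Qed.

(** Collecting the coordinates of [G] into a parameter tuple gives one formula in a single variable
    for all [g], to which VC-minimality applies. *)
Lemma dfn_one_variable (G : ctx) (P : G -> cU -> Prop) :
  @dfn L U (ctxX G cU) (fun gu => P gu.1 gu.2) ->
  exists m (theta : formula L (1 + m)) (e : G -> m.-tuple U),
    forall g u, P g u <-> holds theta [tuple of [tuple u] ++ e g].
Proof.
move=> [m [f [t [Ct h]]]].
have /boolp.choice[c hc] (i : 'I_m) : exists o, match o with
    | Some c => t i = (c : G -> U) \o fst | None => t i = snd end.
  have [[c _ e]|[_ -> e]] := Ct i; first by exists (Some c).
  by exists None.
have [u0] := carrier_inh U.
exists m, (rename f (fun i => if c i is Some _ then rshift 1 i else lshift m ord0)).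
exists (fun g => [tuple odflt (fun=> u0) (c i) g | i < m]) => g u.
rewrite (h (g, u)) holds_rename.
suff -> : [tuple t i (g, u) | i < m] = [tuple tnth
  [tuple of [tuple u] ++ [tuple odflt (fun=> u0) (c i0) g | i0 < m]]
  (if c i is Some _ then rshift 1 i else lshift m ord0) | i < m] by [].
apply: eq_from_tnth => i; rewrite !tnth_mktuple; have := hc i.
case ci: (c i) => [d|] -> /=; last by rewrite tnth_lshift tnth0.
by rewrite tnth_rshift tnth_mktuple ci.
Qed.

Variable Delta : forall m, set (formula L (1 + m)).
Hypothesis dirD : directed U Delta.

(** The whole structure is added to the instances because complementation is the sum with it; the
    family stays laminar. *)
Definition ball (B : U -> bool) := B = (fun=> true) \/
  exists m d (b : m.-tuple U), Delta d /\
    B = fun u => `[< holds d [tuple of [tuple u] ++ b] >].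

Lemma ball_laminar : laminar ball.
Proof.
move=> B C [->|[m [d [b [Dd ->]]]]]; first by constructor 2; apply/subbP.
move=> [->|[m' [d' [b' [Dd' ->]]]]]; first by constructor 1; apply/subbP.
have [h|h|h] := dirD b b' Dd Dd'.
- by constructor 1; apply/subbP => u /asboolP hu; apply/asboolP; apply: h.
- by constructor 2; apply/subbP => u /asboolP hu; apply/asboolP; apply: h.
constructor 3 => u /asboolP hu /asboolP hu'.
by have : set0 [tuple u] by rewrite -h.
Qed.

Definition ball_family (Z : ctx) (delta : Z -> U -> bool) : set (U -> bool) :=
  [set B | exists z, B = delta z].

Definition system (Z : ctx) (delta : Z -> U -> bool) :=
  [/\ @dfn L U (ctxX Z cU) (fun zu => delta zu.1 zu.2),
      forall z, ball (delta z) & exists z : Z, True].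

Definition full_family (_ : ctx1 U) (_ : U) := true.

Lemma system_full : system full_family.
Proof.
split=> [|z|]; [exact: (@dfnC_const L U _ _ true) | by left | by exists tt].
Qed.

Hypothesis hM : monster U.
Hypothesis hV : forall theta : pformula U 1,
  exists2 beta : pformula U 1, bool_comb Delta beta & equivalent theta beta.

Lemma saturated0 n (p : set (pformula U n)) :
  p `<=` @Defs.over L U n set0 -> consistent p ->
  exists a : n.-tuple U, forall theta, p theta -> pholds theta a.
Proof.
have [K [small _ _ sat _]] := hM.
apply: sat; apply: contra small => le.
by apply: card_le_trans le _; apply: card_ge0.
Qed.

Section TwoElements.
Hypothesis two : exists u v : U, u <> v.

Lemma system_join (Z1 Z2 : ctx) (d1 : Z1 -> U -> bool) (d2 : Z2 -> U -> bool) :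
  system d1 -> system d2 -> exists (Z : ctx) (d : Z -> U -> bool),
    [/\ system d, ball_family d1 `<=` ball_family d & ball_family d2 `<=` ball_family d].
Proof.
move=> [df1 b1 [z1 _]] [df2 b2 [z2 _]].
have [u [v uv]] := two.
pose Z := ctxX Z1 (ctxX Z2 (ctxX cU cU)).
(* The equality pattern of two extra coordinates selects the family. *)
pose d (z : Z) y := if `[< z.2.2.1 = z.2.2.2 >] then d1 z.1 y else d2 z.2.1 y.
have e1 z : d (z, (z2, (u, u))) = d1 z.
  by apply: funext => y; rewrite /d /=; case: asboolP.
have e2 z : d (z1, (z, (u, v))) = d2 z.
  by apply: funext => y; rewrite /d /=; case: asboolP.
exists Z, d; split; first split.
- have m1 : @cmap L U (ctxX Z cU) cU (fun zy => zy.1.2.2.1).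
    exact: cmap_comp (cmap_comp (cmap_comp (@cmap_fst _ _ _ _) (@cmap_snd _ _ _ _))
      (@cmap_snd _ _ _ _)) (@cmap_fst _ _ _ _).
  have m2 : @cmap L U (ctxX Z cU) cU (fun zy => zy.1.2.2.2).
    exact: cmap_comp (cmap_comp (cmap_comp (@cmap_fst _ _ _ _) (@cmap_snd _ _ _ _))
      (@cmap_snd _ _ _ _)) (@cmap_snd _ _ _ _).
  have m3 : @cmap L U (ctxX Z cU) (ctxX Z1 cU) (fun zy => (zy.1.1, zy.2)).
    apply: cmap_pair (@cmap_snd _ _ _ _).
    exact: cmap_comp (@cmap_fst _ _ _ _) (@cmap_fst _ _ _ _).
  have m4 : @cmap L U (ctxX Z cU) (ctxX Z2 cU) (fun zy => (zy.1.2.1, zy.2)).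
    apply: cmap_pair (@cmap_snd _ _ _ _).
    exact: cmap_comp (cmap_comp (@cmap_fst _ _ _ _) (@cmap_snd _ _ _ _))
      (@cmap_fst _ _ _ _).
  have deq := dfn_eq m1 m2.
  apply: dfnC_ext (dfnC_or (dfnC_and deq (dfn_comp m3 df1))
    (dfnC_and (dfnC_not deq) (dfn_comp m4 df2))) => -[z y] /=; rewrite /d.
  by case: asboolP => h; split=> [[[e hd]|[e hd]]|hd] //; by [left | right].
- move=> z; have -> : d z = if `[< z.2.2.1 = z.2.2.2 >] then d1 z.1 else d2 z.2.1.
    by apply: funext => y; rewrite /d; case: asboolP.
  by case: asboolP.
- by exists (z1, (z2, (u, u))).
- by move=> B [z ->]; exists (z, (z2, (u, u))); rewrite e1.
- by move=> B [z ->]; exists (z1, (z, (u, v))); rewrite e2.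
Qed.

(** The family and the number of balls depend on [beta] only, while the parameters [b] vary freely;
    this is the uniformity that compactness needs. *)
Lemma bool_comb_xrep (beta : pformula U 1) : bool_comb Delta beta ->
  exists (Z : ctx) (d : Z -> U -> bool) k, system d /\
    forall b : (plen beta).-tuple U,
      xrep (ball_family d) k (fun u => `[< holds (pform beta) [tuple of [tuple u] ++ b] >]).
Proof.
elim=> [m d b Dd|theta _ [Z [d [k [sd hd]]]]|
        theta eta _ [Z [d [k [sd hd]]]] _ [Z' [d' [k' [sd' hd']]]]].
- pose dl (z : ctxT m cU) (u : U) := `[< holds d [tuple of [tuple u] ++ z] >].
  have sdl : @dfn L U (ctxX (ctxT m cU) cU) (fun zu => dl zu.1 zu.2).
    have dh : @dfn L U (ctxX (ctxT m cU) cU)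
        (fun zu => holds d [tuple of [tuple zu.2] ++ zu.1]).
      apply: (@dfn_holds (ctxX (ctxT m cU) cU)).
      apply: (@cmap_cat (ctxX (ctxT m cU) cU) cU 1 m (fun zu => [tuple zu.2])).
        by apply: (@cmap_tuple1 (ctxX (ctxT m cU) cU) cU); exact: cmap_snd.
      exact: cmap_fst.
    by apply: dfnC_ext dh => zu; split=> /asboolP.
  exists (ctxT m cU), dl, 1; split=> [|b']; last by apply: xrep_ball; exists b'.
  split; [exact: sdl | by move=> z; right; exists m, d, z | by exists b].
- have [Z1 [d1 [sd1 h1 h2]]] := system_join sd system_full.
  have full : ball_family d1 (fun=> true) by apply: h2; exists tt.
  exists Z1, d1, k.+1; split=> // b.
  have [R sR [RB RD]] := xrep_neg full (xrep_sub h1 (hd b)).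
  exists R => //; split=> // x; rewrite RD /=.
  by case: asboolP => h; case: asboolP.
have [Z1 [d1 [sd1 h1 h2]]] := system_join sd sd'.
exists Z1, d1, (k * k'); split=> // b.
pose b1 := [tuple tnth b (lshift (plen eta) i) | i < plen theta].
pose b2 := [tuple tnth b (rshift (plen theta) i) | i < plen eta].
have eb : b = [tuple of b1 ++ b2].
  apply: eq_from_tnth => i; case: (splitP i) => a e.
    have -> : i = lshift (plen eta) a by exact: val_inj.
    by rewrite tnth_lshift tnth_mktuple.
  have -> : i = rshift (plen theta) a by exact: val_inj.
  by rewrite tnth_rshift tnth_mktuple.
have lam : laminar (ball_family d1).
  by move=> B C [z ->] [z' ->]; case: sd1 => _ hb _; apply: ball_laminar.
have [R sR [RB RD]] := xrep_and lam (xrep_sub h1 (hd b1)) (xrep_sub h2 (hd' b2)).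
exists R => //; split=> // u; rewrite RD eb.
have := pholds_and (PFormula (pform theta) b1) (PFormula (pform eta) b2) [tuple u].
rewrite /pholds [plen (PFormula _ _)]/= [pform (PFormula (pform theta) b1)]/=
  [pform (PFormula (pform eta) b2)]/= => e.
apply/andP/asboolP => [[/asboolP h /asboolP h']|/e [h h']]; first exact/e.
by split; apply/asboolP.
Qed.

Lemma finite_bool_comb_xrep N (beta : 'I_N -> pformula U 1) :
  (forall i, bool_comb Delta (beta i)) ->
  exists (Z : ctx) (d : Z -> U -> bool) k, system d /\
    forall i (b : (plen (beta i)).-tuple U),
      xrep (ball_family d) k (fun u => `[< holds (pform (beta i)) [tuple of [tuple u] ++ b] >]).
Proof.
move=> hb; suff H (r : seq 'I_N) :
  exists (Z : ctx) (d : Z -> U -> bool) k, system d /\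
    forall i (b : (plen (beta i)).-tuple U), i \in r ->
      xrep (ball_family d) k (fun u => `[< holds (pform (beta i)) [tuple of [tuple u] ++ b] >]).
  have [Z [d [k [sd h]]]] := H (enum 'I_N).
  by exists Z, d, k; split=> // i b; apply: h; rewrite mem_enum.
elim: r => [|j r [Z [d [k [sd h]]]]].
  by exists (ctx1 U), full_family, 0; split=> //; apply: system_full.
have [Z' [d' [k' [sd' h']]]] := bool_comb_xrep (hb j).
have [Z1 [d1 [sd1 sub sub']]] := system_join sd sd'.
exists Z1, d1, (maxn k k'); split=> // i b; rewrite inE => /orP[/eqP e|ir].
  by subst i; apply: xrep_leq (leq_maxr _ _) _; apply: xrep_sub sub' (h' b).
by apply: xrep_leq (leq_maxl _ _) _; apply: xrep_sub sub (h i b ir).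
Qed.

(* Saturation makes the number of balls needed, and the formulas of [Delta]
   they come from, uniform in the parameters. *)
Lemma uniform_xrep2 (G : ctx) (P : G -> cU -> Prop) :
  @dfn L U (ctxX G cU) (fun gu => P gu.1 gu.2) ->
  exists (Z : ctx) (d : Z -> U -> bool) k, system d /\
    forall g, xrep (ball_family d) k (fun u => `[< P g u >]).
Proof.
move=> /dfn_one_variable[m [theta [e he]]].
(* [Q beta a] states that no choice of parameters makes the formula of [beta] define the same set as
   [theta] with parameters [a]. *)
pose Q (beta : pformula U 1) (a : ctxT m cU) := ~ exists z : ctxT (plen beta) cU,
  forall u : cU, holds theta [tuple of [tuple u] ++ a] <->
    holds (pform beta) [tuple of [tuple u] ++ z].
have dQ beta : dfn (Q beta).
  apply: dfnC_not; apply: dfn_ex; apply: dfn_all.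
  set G3 := ctxX _ cU.
  apply: dfnC_iff.
    apply: (@dfn_holds G3); apply: (@cmap_cat G3 cU 1 m (fun g => [tuple g.2])).
      by apply: (@cmap_tuple1 G3 cU); exact: cmap_snd.
    exact: cmap_comp (@cmap_fst _ _ _ _) (@cmap_fst _ _ _ _).
  apply: (@dfn_holds G3); apply: (@cmap_cat G3 cU 1 (plen beta) (fun g => [tuple g.2])).
    by apply: (@cmap_tuple1 G3 cU); exact: cmap_snd.
  exact: cmap_comp (@cmap_fst _ _ _ _) (@cmap_snd _ _ _ _).
have /boolp.choice[psi hpsi] beta := dfn_formula (dQ beta).
pose p : set (pformula U m) := [set tau | exists2 beta, bool_comb Delta beta &
  tau = PFormula (psi beta) [tuple]].
(* A realisation [a] of [p] would contradict VC-minimality for [theta] at [a]. So some finite part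
   of [p] is unsatisfiable, and the finitely many combinations in it serve all parameters. *)
have npc : ~ consistent p.
  move=> cp; have [|a ha] := saturated0 _ cp.
    by move=> _ [beta _ ->] [].
  have [beta bc eq] := hV (PFormula theta a).
  have /hpsi := ha (PFormula (psi beta) [tuple]) (ex_intro2 _ _ beta bc erefl).
  by apply; exists (ppar beta) => u; apply: (eq [tuple u]).
have [q [qp fq nq]] : exists q, [/\ q `<=` p, finite_set q &
    forall a, exists2 tau, q tau & ~ pholds tau a].
  apply: contrapT => no; apply: npc => q qp fq.
  apply: contrapT => na; apply: no; exists q; split=> // a.
  apply: contrapT => nt; apply: na; exists a => tau qt.
  by apply: contrapT => nh; apply: nt; exists tau.
have /finite_setP[N /card_eq_enum[f [_ hf]]] := fq.
have /boolp.choice[beta hb] (i : 'I_N) : exists beta, bool_comb Delta beta /\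
    f i = PFormula (psi beta) [tuple].
  have [|beta bc eb] := qp (f i); last by exists beta.
  by apply/hf; exists i.
have [Z [d [k [sd hd]]]] := finite_bool_comb_xrep (fun i => (hb i).1).
exists Z, d, k; split=> // g; have [tau /hf[i <-]] := nq (e g).
rewrite (hb i).2 => nh; have [z hz] : exists z : ctxT (plen (beta i)) cU,
    forall u : cU, holds theta [tuple of [tuple u] ++ e g] <->
    holds (pform (beta i)) [tuple of [tuple u] ++ z].
  by apply: contrapT => nz; apply: nh; apply/hpsi.
have [R sR [RB RD]] := hd i z.
exists R => //; split=> // u; rewrite RD.
by apply/asboolP/asboolP => h; [apply/he/hz | apply/hz/he].
Qed.

End TwoElements.

(** Joining families uses two distinct elements; in a structure with a single element every set is
    empty or full. *)
Lemma uniform_xrep (G : ctx) (P : G -> cU -> Prop) :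
  @dfn L U (ctxX G cU) (fun gu => P gu.1 gu.2) ->
  exists (Z : ctx) (d : Z -> U -> bool) k,
    [/\ system d, ball_family d (fun=> true) &
        forall g, xrep (ball_family d) k (fun u => `[< P g u >])].
Proof.
move=> dP; have [two|one] := pselect (exists u v : U, u <> v).
  have [Z [d [k [sd hd]]]] := uniform_xrep2 two dP.
  have [Z' [d' [sd' h h']]] := system_join two sd system_full.
  exists Z', d', k; split=> // [|g]; first by apply: h'; exists tt.
  exact: xrep_sub h (hd g).
exists (ctx1 U), full_family, 1; split; [exact: system_full | by exists tt | move=> g].
have [u0] := carrier_inh U.
have all_eq u : u = u0 by apply: contrapT => ne; apply: one; exists u, u0.
have [Pg|nP] := pselect (P g u0).
  exists [:: fun=> true] => //; split=> [C|u]; first by rewrite inE => /eqP ->; exists tt.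
  by rewrite xors_cons /xors big_nil; apply/esym/asboolP; rewrite (all_eq u).
exists [::] => //; split=> // u.
by rewrite /xors big_nil; apply/esym/asboolPn; rewrite (all_eq u).
Qed.

(** At most [k] balls are summed, and each changes at most twice along a list in which it is
    convex. *)
Lemma uniform_changes (G : ctx) (P : G -> cU -> Prop) :
  @dfn L U (ctxX G cU) (fun gu => P gu.1 gu.2) ->
  exists K, forall g x s, (forall B, ball B -> convex B (x :: s)) ->
    changes (fun u => `[< P g u >]) x s <= K.
Proof.
move=> /uniform_xrep[Z [d [k [[_ bd _] _ hd]]]]; exists (k * 2) => g x s cs.
have [R sR [RB RD]] := hd g.
have -> : (fun u => `[< P g u >]) = xors R by apply: funext => u; rewrite RD.
apply: leq_trans (_ : size R * 2 <= _); last by rewrite leq_mul2r sR.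
apply: changes_xors => C /RB[z ->]; apply: convex_changes (erefl (x :: s)).
exact: cs.
Qed.

(** * Definability of minimal representations *)

Section MinimalRepresentations.
Variables (Z G : ctx) (d : Z -> U -> bool) (D : G -> U -> bool) (k : nat).
Hypothesis dd : @dfn L U (ctxX Z cU) (fun zu => d zu.1 zu.2).
Hypothesis dD : @dfn L U (ctxX G cU) (fun gu => D gu.1 gu.2).
Hypothesis repD : forall g, xrep (ball_family d) k (D g).

Let repT j (g : G) (z : j.-tuple Z) := forall u, xors (map d z) u = D g u.

(** Minimality concerns only the finitely many smaller lengths, hence is expressible by a
    formula. *)
Let minT j (g : G) (z : j.-tuple Z) :=
  repT g z /\ forall i : 'I_j, ~ exists z' : i.-tuple Z, repT g z'.

Lemma dfn_xors j (H : ctx) (r : H -> ctxT j Z) (q : H -> cU) :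
  cmap r -> cmap q -> dfn (fun h => xors (map d (r h)) (q h)).
Proof.
move=> hr hq.
have -> : (fun h => is_true (xors (map d (r h)) (q h))) =
    (fun h => is_true (\big[addb/false]_(i <- index_enum 'I_j) d (tnth (r h) i) (q h))).
  by apply: funext => h; rewrite /xors big_map big_tuple.
apply: dfnC_xor => i.
exact: (dfn_comp (cmap_pair (cmap_tnth i hr) hq) dd).
Qed.

Lemma dfn_minT j : @dfn L U (ctxX G (ctxT j Z)) (fun gz => minT gz.1 gz.2).
Proof.
have drep i (H : ctx) (r : H -> G) (q : H -> ctxT i Z) : cmap r -> cmap q ->
    dfn (fun h => repT (r h) (q h)).
  move=> hr hq; apply: (@dfn_all L U H cU (fun h u => xors (map d (q h)) u = D (r h) u)); set H' := ctxX H cU.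
  have dx : @dfn L U H' (fun hu => xors (map d (q hu.1)) hu.2).
    by apply: dfn_xors; [exact: cmap_comp (@cmap_fst _ _ _ _) hq | exact: cmap_snd].
  have dy : @dfn L U H' (fun hu => D (r hu.1) hu.2).
    have cm : @cmap L U H' (ctxX G cU) (fun hu => (r hu.1, hu.2)).
      by apply: cmap_pair; [exact: cmap_comp (@cmap_fst _ _ _ _) hr | exact: cmap_snd].
    exact: (dfn_comp cm dD).
  apply: dfnC_ext (dfnC_iff dx dy) => hu.
  by split=> [e|->//]; apply/idP/idP => /e.
apply: dfnC_and; first by apply: drep; [exact: cmap_fst | exact: cmap_snd].
apply: dfnC_bigall => i; apply: dfnC_not.
set H := ctxX G (ctxT j Z).
apply: (@dfn_ex L U H (ctxT i Z) (fun h z' => repT h.1 z')).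
by apply: drep; [exact: cmap_comp (@cmap_fst _ _ _ _) (@cmap_fst _ _ _ _) | exact: cmap_snd].
Qed.

Lemma ball_family_tuple R : (forall C, C \in R -> ball_family d C) ->
  exists z : (size R).-tuple Z, map d z = R.
Proof.
elim: R => [|C R IH] RB; first by exists [tuple].
have [z0 ->] := RB C (mem_head _ _).
have [|z ez] := IH; first by move=> B BR; apply: RB; rewrite inE BR orbT.
by exists [tuple of z0 :: z]; rewrite /= ez.
Qed.

(** Minimal representations have at most [k] balls, so quantifying over them is a finite
    disjunction, over the length, of quantifiers over tuples of indices. *)
Lemma dfn_minrep (Phi : G -> seq (U -> bool) -> Prop) :
  (forall j, @dfn L U (ctxX G (ctxT j Z)) (fun gz => Phi gz.1 (map d gz.2))) ->
  dfn (fun g => exists2 R, minrep (ball_family d) (D g) R & Phi g R).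
Proof.
move=> dPhi.
have famT j (z : j.-tuple Z) C : C \in map d z -> ball_family d C.
  by elim: (tval z) => //= z0 l IH; rewrite inE => /orP[/eqP ->|//]; exists z0.
suff E g : (exists j : 'I_k.+1, exists z : ctxT j Z, minT g z /\ Phi g (map d z)) <->
    exists2 R, minrep (ball_family d) (D g) R & Phi g R.
  apply: dfnC_ext E _; apply: dfnC_bigex => j.
  apply: (@dfn_ex L U G (ctxT j Z) (fun g z => minT g z /\ Phi g (map d z))).
  by apply: dfnC_and; [exact: dfn_minT | exact: dPhi].
split=> [[j [z [[rz mz] Pz]]]|[R mR PR]].
  exists (map d z) => //; split; first by split=> // C; apply: famT.
  move=> R [RB RD]; rewrite size_map size_tuple leqNgt; apply/negP => lt.
  have [z' ez'] := ball_family_tuple RB.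
  by apply: (mz (Ordinal lt)); exists z' => u; rewrite ez'.
have [[RB RD] min] := mR; have [z ez] := ball_family_tuple RB.
have lt : size R < k.+1.
  have [R' rR' s'] := xrep_minrep (repD g).
  by rewrite ltnS (minrep_size mR rR').
exists (Ordinal lt), z; rewrite ez; split=> //; split=> [u|i [z' rz']].
  by rewrite ez.
have /min : xors_repr (ball_family d) (D g) (map d z').
  by split=> // C; apply: famT.
by rewrite size_map size_tuple leqNgt ltn_ord.
Qed.

End MinimalRepresentations.

End Systems.

(** * Counting types *)

Lemma occ_bound_leq j k : j <= k -> occ_bound j <= occ_bound k.
Proof.
elim: j k => // j IH [//|k]; rewrite ltnS => le /=.
by apply: leq_mul; rewrite ?leq_add2l ?IH // leq_mul2l /= ltnS.
Qed.

Lemma card_setU_family (I T : finType) (F : I -> {set T}) c :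
  (forall i, #|F i| <= c) -> #|\bigcup_(i in I) F i|%SET <= #|I| * c.
Proof.
move=> h; apply: leq_trans (_ : \sum_(i in I) #|F i| <= _).
  elim/big_ind2: _ => [|A a B b hA hB|i _]; rewrite ?cards0 //.
  by apply: leq_trans (leq_card_setU _ _).1 _; apply: leq_add.
by rewrite -sum_nat_const; apply: leq_sum.
Qed.

Lemma card_set_seq (T : finType) (A : {set T}) (s : seq T) :
  (forall x, x \in A -> x \in s) -> #|A| <= size s.
Proof. by move=> h; apply: leq_trans (card_size s); apply/subset_leq_card/fintype.subsetP. Qed.

Lemma all_notin_ever (X : Type) (E : finType) (P : X -> {set E}) e x s :
  e \notin ever P x s -> all (fun y => e \notin P y) (x :: s).
Proof.
elim: s x => [|y s IH] x /=; rewrite finset.in_setU negb_or => /andP[->] //=.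
exact: IH.
Qed.

Section Count.
Variables (L : language) (U : structure L).
Local Notation ctx := (ctx U).
Local Notation cU := (ctxU U).
Variable Delta : forall m, set (formula L (1 + m)).
Hypothesis dirD : directed U Delta.
Hypothesis hM : monster U.
Hypothesis hV : forall theta : pformula U 1,
  exists2 beta : pformula U 1, bool_comb Delta beta & equivalent theta beta.

Section Cells.
Variables (Z : ctx) (d : Z -> U -> bool).
Hypothesis dd : @dfn L U (ctxX Z cU) (fun zu => d zu.1 zu.2).
Implicit Types (D B : U -> bool).

Definition occurs D B := exists2 R, minrep (ball_family d) D R & B \in R.

(** This is the truth value of [D] at the generic type of [B], as read in some minimal
    representation; at the balls chosen in [cells_cover] all minimal representations agree. *)
Definition generic D B := exists2 R, minrep (ball_family d) D R & above R B.

Lemma dfn_subb (H : ctx) (r q : H -> Z) : cmap r -> cmap q ->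
  dfn (fun h => subb (d (r h)) (d (q h))).
Proof.
move=> hr hq; set H' := ctxX H cU.
have m (p : H -> Z) : cmap p -> @cmap L U H' (ctxX Z cU) (fun hu => (p hu.1, hu.2)).
  by move=> hp; apply: cmap_pair; [exact: cmap_comp (@cmap_fst _ _ _ _) hp | exact: cmap_snd].
have dall : dfn (fun h => forall u : cU, d (r h) u -> d (q h) u).
  apply: dfn_all; apply: dfnC_imp; [exact: dfn_comp (m _ hr) dd | exact: dfn_comp (m _ hq) dd].
by apply: dfnC_ext dall => h; split=> /subbP.
Qed.

Lemma dfn_ball_eq (H : ctx) (r q : H -> Z) : cmap r -> cmap q ->
  dfn (fun h => d (r h) = d (q h)).
Proof.
move=> hr hq; apply: dfnC_ext (dfnC_and (dfn_subb hr hq) (dfn_subb hq hr)) => h.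
by split=> [[s s']|->]; [exact: subb_anti | split; exact: subb_refl].
Qed.

Section Families.
Variables (G : ctx) (D : G -> U -> bool) (k : nat) (beta : G -> Z).
Hypothesis dD : @dfn L U (ctxX G cU) (fun gu => D gu.1 gu.2).
Hypothesis repD : forall g, xrep (ball_family d) k (D g).
Hypothesis mbeta : cmap beta.

Lemma dfn_occurs : dfn (fun g => occurs (D g) (d (beta g))).
Proof.
apply: (@dfn_minrep _ _ _ _ _ _ _ dd dD repD (fun g R => d (beta g) \in R)) => j.
set G' := ctxX G (ctxT j Z).
have mb : @cmap L U G' Z (fun g => beta g.1) := cmap_comp (@cmap_fst _ _ _ _) mbeta.
have mi (i : 'I_j) : @cmap L U G' Z (fun g => tnth g.2 i).
  by apply: (@cmap_tnth _ _ G' Z j snd i); exact: cmap_snd.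
apply: dfnC_ext (dfnC_bigex (fun i => dfn_ball_eq mb (mi i))) => -[g z] /=.
split=> [[i e]|/(@tnthP _ _ (map_tuple d z))[i e]].
  by apply/(@tnthP _ _ (map_tuple d z)); exists i; rewrite tnth_map.
by exists i; rewrite e tnth_map.
Qed.

Lemma dfn_generic : dfn (fun g => generic (D g) (d (beta g))).
Proof.
apply: (@dfn_minrep _ _ _ _ _ _ _ dd dD repD (fun g R => above R (d (beta g)))) => j.
set G' := ctxX G (ctxT j Z).
have mb : @cmap L U G' Z (fun g => beta g.1) := cmap_comp (@cmap_fst _ _ _ _) mbeta.
have mi (i : 'I_j) : @cmap L U G' Z (fun g => tnth g.2 i).
  by apply: (@cmap_tnth _ _ G' Z j snd i); exact: cmap_snd.
apply: dfnC_ext (dfnC_xor (index_enum 'I_j) (fun i => dfn_subb mb (mi i))) => -[g z] /=.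
by rewrite /above big_map big_tuple.
Qed.

End Families.
End Cells.

Variables (A : ctx) (P : A -> U -> U -> Prop).
Hypothesis dP : @dfn L U (ctxX (ctxX A cU) cU) (fun g => P g.1.1 g.1.2 g.2).

Definition fiber (ab : A * U) (y : U) : bool := `[< P ab.1 ab.2 y >].

Section Cover.
Variables (Z : ctx) (d : Z -> U -> bool) (k : nat).
Hypothesis sd : system Delta d.
Hypothesis full : ball_family d (fun=> true).
Hypothesis repD : forall ab, xrep (ball_family d) k (fiber ab).
Let lam : laminar (ball_family d).
Proof. by move=> B C [z ->] [z' ->]; case: sd => _ hb _; apply: ball_laminar (hb z) (hb z'). Qed.

Variables (n : nat) (a : 'I_n -> A).

Definition cell b B : {set 'I_n} := [set i | `[< generic d (fiber (a i, b)) B >]].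

(** The full set is included so that every point lies in some candidate. *)
Definition candidate i b B := ball_family d B /\
  (occurs d (fiber (a i, b)) B \/ B = (fun=> true)).

Definition cells i b : {set {set 'I_n}} :=
  [set T | `[< exists B, candidate i b B /\ T = cell b B >]].

Lemma cells_gt0 i b : 0 < #|cells i b|.
Proof.
apply/card_gt0P; exists (cell b (fun=> true)); rewrite inE; apply/asboolP.
by exists (fun=> true); split=> //; split=> //; right.
Qed.

Lemma candidate_finite i b : exists2 F : seq (U -> bool), size F <= (occ_bound k).+1 &
  forall B, candidate i b B -> B \in F.
Proof.
have [R0 m0 s0] := xrep_minrep (repD (a i, b)).
have [F sF hF] := occ_finite lam m0.
exists ((fun=> true) :: F) => [|B [_ [[R mR BR]|->]]].
- by rewrite /= ltnS (leq_trans sF) // occ_bound_leq.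
- by rewrite inE (hF R) ?orbT.
- exact: mem_head.
Qed.

Lemma card_cells i b : #|cells i b| <= (occ_bound k).+1.
Proof.
have [F sF hF] := candidate_finite i b.
apply: leq_trans sF; rewrite -(size_map (cell b)); apply: card_set_seq => T.
by rewrite inE => /asboolP[B [/hF BF ->]]; apply: map_f.
Qed.

(* The cell of the least candidate ball containing [c] is the type of [c]: no
   ball of a minimal representation separates [c] from the rest of it. *)
Lemma cells_cover b c : 0 < n ->
  exists i, [set j | `[< P (a j) b c >]]%SET \in cells i b.
Proof.
move=> n0; have /boolp.choice[F hF] i : exists F : seq (U -> bool),
    forall B, candidate i b B -> B \in F.
  by have [F _ hF] := candidate_finite i b; exists F.
pose cand B := exists i, candidate i b B.
(* These are the candidates, over all [i], that contain [c]; the full set is one of them because [n]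
   is positive. *)
pose R := [seq B <- flatten [seq F i | i <- enum 'I_n] | `[< cand B >] && B c].
have inR B : B \in R <-> cand B /\ B c.
  rewrite mem_filter; split=> [/andP[/andP[/asboolP ? ?] _] //|[[i ci] Bc]].
  apply/andP; split; first by rewrite Bc andbT; apply/asboolP; exists i.
  by apply/flattenP; exists (F i); [apply/mapP; exists i; rewrite ?mem_enum | apply: hF].
have fR : (fun=> true) \in R.
  by apply/inR; split=> //; exists (Ordinal n0); split=> //; right.
have [|E ER Emin] := @exists_minimal _ R; first by case: (R) fR.
have /inR[[i ci] Ec] := ER.
exists i; rewrite inE; apply/asboolP; exists E; split=> //.
apply/setP => j; rewrite !inE; have famE : ball_family d E by case: ci.
have key R' : minrep (ball_family d) (fiber (a j, b)) R' -> above R' E = fiber (a j, b) c.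
  move=> mR'; have [[RB RD] _] := mR'; rewrite -RD; apply: eq_big_seq => C CR'.
  apply/idP/idP => [/subbP/(_ _ Ec) //|Cc].
  have CR : C \in R.
    apply/inR; split=> //; exists j; split; first exact: RB.
    by left; exists R'.
  have [//|/(Emin _ CR) ->|dis] := lam famE (RB _ CR'); first exact: subb_refl.
  by case: (dis c).
have [R0 m0 _] := xrep_minrep (repD (a j, b)).
apply/asboolP/asboolP => [h|[R' mR']].
  by exists R0 => //; rewrite key //; apply/asboolP.
by rewrite key // => /asboolP.
Qed.

End Cover.

Section Variation.
Variables (Z : ctx) (d : Z -> U -> bool) (k W : nat).
Hypothesis sd : system Delta d.
Hypothesis repD : forall ab, xrep (ball_family d) k (fiber ab).

(** Quantifying over the ball makes this a definable condition on [b], although a single candidate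
    need not be definable from its parameters. *)
Definition pattern (sg : {ffun 'I_W -> bool}) (g : A * W.-tuple A) (b : U) :=
  exists z : Z, (occurs d (fiber (g.1, b)) (d z) \/ d z = (fun=> true)) /\
    forall w : 'I_W, `[< generic d (fiber (tnth g.2 w, b)) (d z) >] = sg w.

Lemma dfn_pattern sg :
  @dfn L U (ctxX (ctxX A (ctxT W A)) cU) (fun gb => pattern sg gb.1 gb.2).
Proof.
have [dd _ _] := sd; set G := ctxX _ cU.
pose H := ctxX G Z.
apply: (@dfn_ex L U G Z (fun gb z =>
  (occurs d (fiber (gb.1.1, gb.2)) (d z) \/ d z = (fun=> true)) /\
    forall w : 'I_W, `[< generic d (fiber (tnth gb.1.2 w, gb.2)) (d z) >] = sg w)).
have mz : @cmap L U H Z snd by exact: cmap_snd.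
have mb : @cmap L U H cU (fun h => h.1.2).
  exact: cmap_comp (@cmap_fst _ _ _ _) (@cmap_snd _ _ _ _).
have mg : @cmap L U H (ctxX A (ctxT W A)) (fun h => h.1.1).
  exact: cmap_comp (@cmap_fst _ _ _ _) (@cmap_fst _ _ _ _).
have ma : @cmap L U H A (fun h => h.1.1.1) := cmap_comp mg (@cmap_fst _ _ _ _).
have mw (w : 'I_W) : @cmap L U H A (fun h => tnth h.1.1.2 w).
  by apply: (@cmap_tnth _ _ H A W (fun h => h.1.1.2) w);
    exact: cmap_comp mg (@cmap_snd _ _ _ _).
have dfib (r : H -> A) : cmap r ->
    @dfn L U (ctxX H cU) (fun hu => fiber (r hu.1, hu.1.1.2) hu.2).
  move=> mr; set H' := ctxX H cU.
  have m : @cmap L U H' (ctxX (ctxX A cU) cU) (fun hu => ((r hu.1, hu.1.1.2), hu.2)).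
    apply: cmap_pair; last exact: cmap_snd.
    by apply: cmap_pair; [exact: cmap_comp (@cmap_fst _ _ _ _) mr |
      exact: cmap_comp (@cmap_fst _ _ _ _) mb].
  by apply: dfnC_ext (dfn_comp m dP) => hu; split=> /asboolP.
apply: dfnC_and.
  apply: dfnC_or.
    exact: (@dfn_occurs Z d dd H (fun h => fiber (h.1.1.1, h.1.2)) k snd (dfib _ ma)
      (fun h => repD _) mz).
  have dall : dfn (fun h : H => forall u : cU, d h.2 u).
    apply: dfn_all; set H' := ctxX H cU.
    have m : @cmap L U H' (ctxX Z cU) (fun hu => (hu.1.2, hu.2)).
      by apply: cmap_pair; [exact: cmap_comp (@cmap_fst _ _ _ _) mz | exact: cmap_snd].
    exact: (dfn_comp m dd).
  apply: dfnC_ext dall => h; split=> [e|-> //].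
  by apply: funext => u; apply: e.
apply: dfnC_bigall => w; apply: dfnC_eqb.
have dg := @dfn_generic Z d dd H (fun h => fiber (tnth h.1.1.2 w, h.1.2)) k snd
  (dfib _ (mw w)) (fun h => repD _) mz.
by apply: dfnC_ext dg => h; split=> /asboolP.
Qed.

(** The trace of [cells] on at most [W] elements is determined by which patterns hold, and each
    pattern changes boundedly often; the constant is the sum over all patterns. *)
Lemma cells_variation : 0 < W -> exists K, forall n (a : 'I_n -> A) i x s
    (l : {set 'I_n}), (forall B, ball Delta B -> convex B (x :: s)) -> #|l| <= W ->
  adjs (jump (cells d a i) l) x s <= K.
Proof.
move=> W0.
have /boolp.choice[K hK] sg := uniform_changes dirD hM hV (dfn_pattern sg).
exists (\sum_sg K sg) => n a i x s l cs lW.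
(* This enumerates [l], padded with [i] when [l] has fewer than [W] elements. *)
pose idx (w : 'I_W) := nth i (enum l) w.
pose g : A * W.-tuple A := (a i, [tuple a (idx w) | w < W]).
have patP b sg : pattern sg g b <-> exists B, candidate d a i b B /\
    forall w, (idx w \in cell d a b B) = sg w.
  split=> [[z [oz hz]]|[B [[[z ->] oz] hz]]].
    exists (d z); split; first by split=> //; exists z.
    by move=> w; rewrite inE -hz tnth_mktuple.
  by exists z; split=> // w; rewrite -hz inE tnth_mktuple.
apply: leq_trans (_ : \sum_sg changes (fun b => `[< pattern sg g b >]) x s <= _); last first.
  by apply: leq_sum => sg _; apply: hK.
rewrite -adjs_sum; apply: adjs_le => b b'; rewrite /jump.
case: eqP => //= ne; apply: contrapT => no; apply: ne.
have same sg : pattern sg g b <-> pattern sg g b'.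
  have /eqP e : `[< pattern sg g b >] == `[< pattern sg g b' >].
    apply: contrapT => ne; apply: no; rewrite (bigD1 sg) //=.
    by move/negP: ne => ->.
  by split=> h; apply/asboolP; [rewrite -e | rewrite e]; apply/asboolP.
have sub c c' : (forall sg, pattern sg g c -> pattern sg g c') ->
    trace (cells d a i c) l \subset trace (cells d a i c') l.
  move=> imp; apply/fintype.subsetP => _ /imsetP[T + ->].
  rewrite inE => /asboolP[B [cB ->]].
  have /patP[B' [cB' hB']] : pattern [ffun w => idx w \in cell d a c B] g c'.
    by apply: imp; apply/patP; exists B; split=> // w; rewrite ffunE.
  have -> : (cell d a c B :&: l = cell d a c' B' :&: l)%SET.
    apply/setP => j; rewrite !finset.in_setI; case: (boolP (j \in l)); rewrite ?andbF //.
    rewrite !andbT => jl.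
    have lt : index j (enum l) < W.
      by apply: leq_trans lW; rewrite cardE index_mem mem_enum.
    have := hB' (Ordinal lt); rewrite ffunE /idx /= nth_index ?mem_enum //.
  by apply: in_trace; rewrite inE; apply/asboolP; exists B'.
by apply/eqP; rewrite finset.eqEsubset !sub // => sg /same.
Qed.

End Variation.

(** One [b] is chosen for each trace, and these are listed in convex order. Each trace is a cell
    over some [i] at its [b], and for each of the [n] indices [i] only O(n) cells occur along the
    list. *)
Theorem count_traces : exists K, forall n (a : 'I_n -> A), 0 < n ->
  #|[set T : {set 'I_n} | `[< exists b c, T = [set j | `[< P (a j) b c >]] >]]%SET|
    <= K * n ^ 2.
Proof.
have [Z [d [k [sd full repD]]]] := uniform_xrep dirD hM hV
  (G := ctxX A cU) (P := fun ab y => P ab.1 ab.2 y) dP.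
pose N := (occ_bound k).+1; pose W := 2 ^ N.
have [|K hK] := cells_variation (W := W) sd repD; first by rewrite expn_gt0.
exists (N * (1 + rank_const K N)) => n a n0.
set H := finset _.
have [u0] := carrier_inh U.
have /boolp.choice[bt hbt] T : exists b, T \in H -> exists c,
    T = [set j | `[< P (a j) b c >]]%SET.
  have [TH|] := boolP (T \in H); last by exists u0.
  by move: TH; rewrite inE => /asboolP[b [c e]]; exists b => _; exists c.
have [s' [_ alls cs]] := convex_order (ball_laminar dirD) (map bt (enum H)).
case: s' => [|x s] in alls cs *.
  have /esym := alls (fun=> false); rewrite all_map => /allP h.
  rewrite (_ : H = finset.set0) ?cards0 //; apply/setP => T; rewrite finset.in_set0.
  by apply/negP => TH; have := h T; rewrite mem_enum => /(_ TH).
have cardE i : #|ever (cells d a i) x s| <= N * (1 + rank_const K N * n).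
  apply: (@card_ever_cover n U (cells d a i) N _ _ x s K W) => //.
  - exact: cells_gt0.
  - exact: card_cells.
  - by move=> l lW; apply: hK.
apply: leq_trans (_ : #|\bigcup_(i in 'I_n) ever (cells d a i) x s|%SET <= _).
  apply/subset_leq_card/fintype.subsetP => T TH; apply: contraT => nT.
  have /allP : all (fun T' => [forall i, T \notin cells d a i (bt T')]) (enum H).
    (* [convex_order] transfers statements about all entries of a list; that [T] is a cell at no
       entry is such a statement, so it passes from [x :: s] to the chosen values [bt T']. *)
    rewrite -(all_map bt (fun b => [forall i, T \notin cells d a i b])) -alls.
    have nTi i : T \notin ever (cells d a i) x s.
      by apply: contra nT => h; apply/finset.bigcupP; exists i.
    have h i := all_notin_ever (nTi i).
    have : forall l, (forall i : 'I_n, all (fun y => T \notin cells d a i y) l) ->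
        all (fun b => [forall i, T \notin cells d a i b]) l.
      elim=> //= y l IH hl; rewrite IH ?andbT; first by apply/forallP => i; case/andP: (hl i).
      by move=> i; case/andP: (hl i).
    by apply.
  move=> /(_ T); rewrite mem_enum => /(_ TH)/forallP ni.
  have [c e] := hbt T TH.
  have [i] := cells_cover sd full repD a (bt T) c n0.
  by rewrite -e (negPf (ni i)).
apply: leq_trans (card_setU_family cardE) _; rewrite card_ord.
by nia.
Qed.

End Count.

(** * From maximal consistent sets to traces *)

(** Over a finite set, a maximal consistent set of instances consists of all instances true at some
    point, so the trace of that point determines it. *)
Lemma types_trace_bound (L : language) (U : structure L) n m
    (phi : formula L (n + m)) k (a : 'I_k -> n.-tuple U) (B : set (n.-tuple U)) :
  (forall x, B x <-> exists i, a i = x) ->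
  types (opp phi) B #<= `I_#|[set T : {set 'I_k} | `[< exists y : m.-tuple U,
    T = [set j | `[< holds phi [tuple of a j ++ y] >]] >]]%SET|.
Proof.
move=> Ba; set H := finset _.
pose tr (p : set (pformula U m)) : {set 'I_k} :=
  [set i | `[< p (inst (opp phi) (a i)) >]]%SET.
have instB t i : instances (opp phi) B (psign t (inst (opp phi) (a i))).
  by exists (a i), t; split=> //; apply/Ba; exists i.
have signP t i (y : m.-tuple U) : pholds (psign t (inst (opp phi) (a i))) y <->
    `[< holds phi [tuple of a i ++ y] >] = t.
  have e := holds_opp phi (a i) y.
  case: t; split.
  - by move=> /e h; apply/asboolP.
  - by move=> /asboolP/e.
  - by move=> h; apply/asboolPn => /e.
  - by move=> /asboolPn h /e.
have fin : finite_set (instances (opp phi) B).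
  have sub : instances (opp phi) B `<=`
      (fun ti : bool * 'I_k => psign ti.1 (inst (opp phi) (a ti.2))) @` setT.
    by move=> _ [x [t [/Ba[i <-] ->]]]; exists (t, i).
  by apply: sub_finite_set sub _; apply: finite_image; apply: finite_finset.
have typP p : types (opp phi) B p -> exists y : m.-tuple U, forall theta,
    p theta <-> instances (opp phi) B theta /\ pholds theta y.
  (* [p] is itself finite, so consistency applied to all of [p] provides a realisation. *)
  move=> [sub cons max]; have [|y hy] := cons p (fun _ => id).
    exact: sub_finite_set fin.
  exists y; pose q := [set theta | instances (opp phi) B theta /\ pholds theta y].
  have <- : q = p; last by [].
  apply: max => [theta []//||theta pt]; last by split; [exact: sub | exact: hy].
  by move=> r rq _; exists y => theta /rq[].
have trP p y : (forall theta,
    p theta <-> instances (opp phi) B theta /\ pholds theta y) ->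
    tr p = [set j | `[< holds phi [tuple of a j ++ y] >]]%SET.
  move=> hp; apply/setP => i; rewrite !inE.
  have := signP true i y; have := hp (inst (opp phi) (a i)); have := instB true i.
  move=> /= hi e1 e2; apply/asboolP/idP => [/e1[_ /e2]//|/e2 h].
  by apply/e1.
have trH p : types (opp phi) B p -> tr p \in H.
  move=> /typP[y hy]; rewrite inE; apply/asboolP; exists y; exact: trP.
pose f p := index (tr p) (enum H).
have finj : {in types (opp phi) B &, injective f}.
  move=> p p' /set_mem tp /set_mem tp' e.
  have etr : tr p = tr p'.
    have inH q : types (opp phi) B q -> tr q \in enum H by rewrite mem_enum; apply: trH.
    by rewrite -(nth_index finset.set0 (inH p tp)) -/(f p) e nth_index // inH.
  have [y hy] := typP p tp; have [y' hy'] := typP p' tp'.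
  move: etr; rewrite (trP p y hy) (trP p' y' hy') => /setP etr.
  apply/seteqP; suff H' q q' z z' :
      (forall theta, q theta <-> instances (opp phi) B theta /\ pholds theta z) ->
      (forall theta, q' theta <-> instances (opp phi) B theta /\ pholds theta z') ->
      (forall i, `[< holds phi [tuple of a i ++ z] >] =
                 `[< holds phi [tuple of a i ++ z'] >]) -> q `<=` q'.
    split; [apply: (H' _ _ y y') => // i | apply: (H' _ _ y' y) => // i];
      by have := etr i; rewrite !inE.
  move=> hq hq' ez theta /hq[it]; move: (it) => [_ [t [/Ba[i <-] ->]]] /signP h.
  apply/hq'; split; first exact: instB.
  by apply/signP; rewrite -ez.
rewrite -(card_le_eql (inj_card_eq finj)); apply: subset_card_le => _ [p tp <-] /=.
by rewrite /f cardE index_mem mem_enum; apply: trH.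
Qed.

Theorem theorem1p4 (L : language) (T : theory L) (hT : complete T)
  (U : structure L) (hU : models U T) (hM : monster U) (hV : vc_minimal U)
  (n m : nat) (phi : formula L (n + m)) (hm : m <= 2) :
  vc_density_le U phi 2.
Proof.
have [Delta [dirD hD]] := hV.
pose cU := ctxU U; pose A := ctxT n cU.
(* As [m <= 2], every [m]-tuple has this form, so two single variables serve for all these [m]. *)
pose par (b c : U) : m.-tuple U := [tuple if val i == 0 then b else c | i < m].
pose P (a : A) (b c : U) := holds phi [tuple of a ++ par b c].
have dP : @dfn L U (ctxX (ctxX A cU) cU) (fun g => P g.1.1 g.1.2 g.2).
  set G := ctxX _ cU.
  apply: (@dfn_holds L U G); apply: (@cmap_cat L U G cU n m (fun g => g.1.1)).
    exact: cmap_comp (@cmap_fst _ _ _ _) (@cmap_fst _ _ _ _).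
  apply: (@cmap_mktuple L U G cU m (fun i g => if val i == 0 then g.1.2 else g.2)) => i.
  case: (val i == 0); last exact: cmap_snd.
  exact: cmap_comp (@cmap_fst _ _ _ _) (@cmap_snd _ _ _ _).
have [K hK] := count_traces dirD hM hD dP.
exists K => k B [x0 Bx0] /card_eq_enum[a [_ Ba]].
have k0 : 0 < k by have /Ba[i _] := Bx0; apply: leq_ltn_trans (ltn_ord i).
apply: card_le_trans (types_trace_bound phi Ba) _; rewrite card_le_II.
apply: leq_trans (hK k a k0); apply/subset_leq_card/fintype.subsetP => S.
rewrite 2!finset.in_set => /asboolP[y ->]; apply/asboolP.
have [u0] := carrier_inh U.
have [b [c ->]] : exists b c, y = par b c; last by exists b, c.
(* The default [u0] stands for the coordinates missing when [m < 2]. *)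
exists (nth u0 y 0), (nth u0 y 1); apply: eq_from_tnth => i.
rewrite tnth_mktuple (tnth_nth u0).
by case: i => -[|[|i]] //= lt; have := leq_trans lt hm.
Qed.
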